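(* Let $\gamma\in\{0,1,2,3\}$ and consider pairwise disjoint lines $L_j\subset\mathbb{P}^3$ for $j=1,\dots,\gamma$. Let $\Lambda\subseteq\mathrm{Gr}(1,\mathbb{P}^3)$ be the set of lines meeting each $L_j$. Let $h\in\{2,3\}$ and let $\mathbf{C}=(C_1,\dots,C_n)$, $n\ge1$, be an arrangement of full-rank $(h+1)\times4$ complex matrices whose centers do not meet any $L_j$. Then $$\dim\mathcal{L}_{\mathbf{C}}^{\Lambda,3,h}=4-\gamma$$ if and only if one of the following holds: (1) $h=3$; (2) $h=2$, $\gamma\in\{0,1\}$, and there are two disjoint point centers; (3) $\gamma\in\{2,3\}$.
   Context: $\mathrm{Gr}(1,\mathbb{P}^h)$ is the Grassmannian of lines in $\mathbb{P}^h$ over $\mathbb{C}$. A camera is a full-rank $(h+1)\times4$ matrix $C$, with center $\mathbb{P}(\ker C)$ (a point for $h=2$, empty for $h=3$). For a line $E$ spanned by $X_0,X_1$, $C\cdot E$ is the line in $\mathbb{P}^h$ spanned by $CX_0,CX_1$. $\mathcal{L}_{\mathbf{C}}^{\Lambda,3,h}$ is the Zariski closure of the image of the rational map $\Lambda\dashrightarrow\mathrm{Gr}(1,\mathbb{P}^h)^n$, $E\mapsto(C_1\cdot E,\dots,C_n\cdot E)$. For $\gamma=0$, $\Lambda=\mathrm{Gr}(1,\mathbb{P}^3)$. *)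

(* Defs.v *)
From mathcomp Require Import all_boot all_order all_algebra.
From mathcomp Require Import complex.
From mathcomp Require Import classical_sets reals.
From mathcomp Require Import mpoly.

Set Implicit Arguments.
Unset Strict Implicit.
Unset Printing Implicit Defensive.

Import GRing.Theory.

Local Open Scope ring_scope.
Local Open Scope classical_set_scope.

(* A projective linear subspace of P^h is represented by the linear subspace
   of K^(h+1) of which it is the projectivization; [0%VS] is the empty
   subspace, so disjointness is [(U :&: V)%VS = 0%VS]. *)
Record Gr1 (K : fieldType) (h : nat) := Line {
  line_vs :> {vspace 'cV[K]_h.+1};
  dim_line_vs : \dim line_vs == 2%N
}.

Section Grassmannian.
Variables (K : fieldType) (h : nat).

Definition plucker_index := {ab : 'I_h.+1 * 'I_h.+1 | (ab.1 < ab.2)%N}.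

(* The 2 x 2 minors of a basis; another basis rescales them all by the same
   nonzero scalar. *)
Definition plucker (E : Gr1 K h) (ab : plucker_index) : K :=
  let: (a, b) := val ab in
  let x := (vbasis E)`_0 in
  let y := (vbasis E)`_1 in
  x a 0 * y b 0 - x b 0 * y a 0.

End Grassmannian.

Section Zariski.
Variables (K : fieldType) (h n : nat).

Definition gr_prod := 'I_n -> Gr1 K h.

Definition coord_index : finType := ('I_n * plucker_index h)%type.

Definition coords (p : gr_prod) (k : 'I_#|coord_index|) : K :=
  let: (i, ab) := enum_val k in plucker (p i) ab.

Definition multihomogeneous (f : {mpoly K[#|coord_index|]}) : Prop :=
  exists d : 'I_n -> nat, forall m, m \in msupp f ->
    forall i, (\sum_(ab : plucker_index h) m (enum_rank (i, ab)))%N = d i.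

Definition zariski_closed (Z : set gr_prod) : Prop :=
  exists S : set {mpoly K[#|coord_index|]},
    (forall f, S f -> multihomogeneous f) /\
    Z = [set p | forall f, S f -> f.@[coords p] = 0].

Definition zariski_closure (A : set gr_prod) : set gr_prod :=
  \bigcap_(Z in [set Z | zariski_closed Z /\ A `<=` Z]) Z.

Definition irreducible_set (Z : set gr_prod) : Prop :=
  Z !=set0 /\
  forall A B, zariski_closed A -> zariski_closed B ->
    Z `<=` A `|` B -> Z `<=` A \/ Z `<=` B.

Definition irreducible_chain (X : set gr_prod) (d : nat)
    (Z : nat -> set gr_prod) : Prop :=
  (forall i, (i <= d)%N ->
     [/\ zariski_closed (Z i), irreducible_set (Z i) & Z i `<=` X]) /\
  (forall i, (i < d)%N -> Z i `<` Z i.+1).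

(* Krull dimension.  Only meaningful for a closed [X]: its closed subsets are
   then the closed subsets of the ambient space contained in [X]. *)
Definition has_dim (X : set gr_prod) (d : nat) : Prop :=
  (exists Z, irreducible_chain X d Z) /\
  (forall e Z, irreducible_chain X e Z -> (e <= d)%N).

End Zariski.

Section Cameras.
Variables (K : fieldType) (h : nat).

Definition full_rank (m n : nat) (A : 'M[K]_(m, n)) : Prop :=
  \rank A = minn m n.

Definition camera_map (C : 'M[K]_(h.+1, 4)) : 'Hom('cV[K]_4, 'cV[K]_h.+1) :=
  linfun (mulmx C).

Definition center (C : 'M[K]_(h.+1, 4)) : {vspace 'cV[K]_4} :=
  lker (camera_map C).

Definition proj_disjoint (m : nat) (U V : {vspace 'cV[K]_m.+1}) : Prop :=
  (U :&: V = 0)%VS.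

Definition lines_meeting (g : nat) (L : 'I_g -> Gr1 K 3) : set (Gr1 K 3) :=
  [set E | forall j, ~ proj_disjoint E (L j)].

(* As [p i] has dimension 2, the equation forces [E] to miss the center of
   [C i]: the map is defined exactly on the lines that meet no center. *)
Definition camera_image (n : nat) (C : 'I_n -> 'M[K]_(h.+1, 4))
    (Lambda : set (Gr1 K 3)) : set (gr_prod K h n) :=
  [set p | exists2 E, Lambda E &
     forall i, line_vs (p i) = (camera_map (C i) @: E)%VS].

Definition line_multiview_variety (n : nat) (C : 'I_n -> 'M[K]_(h.+1, 4))
    (Lambda : set (Gr1 K 3)) : set (gr_prod K h n) :=
  zariski_closure (camera_image C Lambda).

End Cameras.

(* Main.v *)
Require Import Defs.
From mathcomp Require Import all_boot all_order all_algebra.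
From mathcomp Require Import complex.
From mathcomp Require Import boolp classical_sets reals.
From mathcomp Require Import mpoly.
From mathcomp Require Import ring zify.

(** Why the theorem holds.  The variety is the closure of the image of a family
of lines, so its dimension is found by parametrizing the family.

Upper bound ([chain_length_le], [parametrized_chain_le]).  Suppose that every
point of a set has multihomogeneous coordinates given, up to scalars, by one
of finitely many tuples of polynomials in d variables.  In a chain
Z_0 < ... < Z_e of irreducible closed subsets of its closure choose, for each
k, a form x_k vanishing on Z_(k-1) but not on Z_k, and make all the forms of
one multidegree with the help of a monomial x_0 that does not vanish at a
point of Z_0.  If e > d, then on every chart the x_k satisfy a polynomial
relation, because there are more monomials in them than monomials in the d
variables ([algebraic_dependence]).  Such a relation cannot vanish on Z_e:
divide it by the highest power of x_e dividing it, restrict to Z_(e-1), where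
x_e = 0, and continue downwards; in the end a nonzero constant multiple of a
power of x_0 would vanish on Z_0 ([chain_independent]).

A line in P^3, a line meeting one fixed line, two, or three skew ones has,
after a choice of basis, two spanning vectors with entries among 0, 1 and
respectively 4, 3, 2, 1 free parameters; hence no chain is longer than
4 - g.  If all the cameras have the same center c, only the line modulo c
matters, and it depends on 2 parameters ([projected_chart],
[common_center_chain_le]); so the dimension is then not 4 - g for g < 2.

Lower bound ([chain_exists]).  Take a family of 4 x 2 matrices spanning lines
of the family, affine in its parameters, whose member at the origin misses all
the centers.  Freeing the parameters one at a time gives increasing sets of
lines.  The closures of their images are irreducible, because two members of
an affine family are joined by a line, along which everything is polynomial in
one variable.  They are distinct because of forms that express that the line E
meets a fixed line N through the center of some camera i: the condition only
depends on C_i E and is linear in its minors.  For g at most 1 two different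
centers y1, y2 serve as points through which to choose the lines N, and they
also complete two points of the line at the origin to a basis of the space
([lines_chain], [transversals_chain]); for g at least 2 a single center lying
on none of the given lines is enough ([two_transversals_chain],
[regulus_chain]).  When h = 3 the cameras are invertible, every line N is
allowed, and generic points take over the role of the centers. *)

Set Implicit Arguments.
Unset Strict Implicit.
Unset Printing Implicit Defensive.

Import GRing.Theory Num.Theory.

Local Open Scope ring_scope.
Local Open Scope classical_set_scope.

(** * Algebraic dependence of polynomials *)

(** The base-[N] digits of [i] are the exponents of [x 1], ..., [x k], the
most significant one belonging to [x k]; the power of [x 0] makes the total
degree [w].  With this numbering, the order on indices is the lexicographic
order of monomials. *)
Fixpoint digit_monomial (A : comNzRingType) (x : nat -> A) (N k w i : nat) : A :=
  if k is k'.+1 then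
    x k ^+ (i %/ N ^ k') *
    digit_monomial x N k' (w - i %/ N ^ k') (i %% N ^ k')
  else x 0%N ^+ w.

Lemma big_nat_mulr (V : nmodType) (N M : nat) (F : nat -> V) :
  \sum_(0 <= i < N * M) F i =
  \sum_(0 <= j < N) \sum_(0 <= i < M) F (j * M + i)%N.
Proof.
elim: N => [|N IH]; first by rewrite mul0n !big_nil.
rewrite big_nat_recr //= -IH mulSnr (@big_cat_nat _ _ _ (N * M)) ?leq_addr //=.
congr (_ + _); rewrite -{1}[(N * M)%N]add0n big_addn addKn.
by apply: eq_bigr => i _; rewrite addnC.
Qed.

Lemma digit_monomial_split (A : comNzRingType) (x : nat -> A) (N k w : nat)
    (c : nat -> A) : (0 < N)%N ->
  \sum_(0 <= i < N ^ k.+1) c i * digit_monomial x N k.+1 w i =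
  \sum_(0 <= j < N) x k.+1 ^+ j *
    \sum_(0 <= i < N ^ k) c (j * N ^ k + i)%N * digit_monomial x N k (w - j) i.
Proof.
move=> N0; rewrite expnS big_nat_mulr; apply: eq_bigr => j _.
rewrite mulr_sumr big_nat_cond [RHS]big_nat_cond; apply: eq_bigr => i.
rewrite andbT => /andP[_ hi] /=.
have Nk : (0 < N ^ k)%N by rewrite expn_gt0 N0.
by rewrite divnMDl // divn_small // addn0 modnMDl modn_small // mulrCA.
Qed.

Lemma rmorph_digit_monomial (A B : comNzRingType) (phi : {rmorphism A -> B})
    (x : nat -> A) (N k w i : nat) :
  phi (digit_monomial x N k w i) = digit_monomial (phi \o x) N k w i.
Proof.
by elim: k w i => [|k IH] w i /=; rewrite ?rmorphM ?rmorphXn ?IH.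
Qed.

Lemma msizeM_bound (K : fieldType) d (p q : {mpoly K[d]}) a b :
  (msize p <= a.+1)%N -> (msize q <= b.+1)%N -> (msize (p * q) <= (a + b).+1)%N.
Proof.
have [->|p0] := eqVneq p 0; first by rewrite mul0r msize0.
have [->|q0] := eqVneq q 0; first by rewrite mulr0 msize0.
by rewrite msizeM // => hp hq; have := leq_add hp hq; move: (_ + _)%N => c; lia.
Qed.

Lemma msizeX_le (K : fieldType) d (p : {mpoly K[d]}) m j :
  (msize p <= m.+1)%N -> (msize (p ^+ j) <= (j * m).+1)%N.
Proof.
move=> hp; elim: j => [|j IH]; first by rewrite expr0 msize1.
rewrite exprS mulSn; exact: msizeM_bound.
Qed.

Lemma msize_digit_monomial (K : fieldType) d (x : nat -> {mpoly K[d]}) m N k w i :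
  (forall j, (j <= k)%N -> (msize (x j) <= m.+1)%N) ->
  (k * N <= w)%N -> (i < N ^ k)%N ->
  (msize (digit_monomial x N k w i) <= (w * m).+1)%N.
Proof.
elim: k w i => [|k IH] w i hx hw hi /=; first exact/msizeX_le/hx.
have Nk : (0 < N ^ k)%N by rewrite expn_gt0; case: (N) hi => //; rewrite exp0n.
set j := (i %/ N ^ k)%N.
have hj : (j < N)%N by rewrite ltn_divLR // -expnS.
have jw : (j <= w)%N.
  by rewrite (leq_trans (ltnW hj)) // (leq_trans _ hw) // mulSn leq_addr.
have h1 := msizeX_le j (hx k.+1 (leqnn _)).
have h2 : (msize (digit_monomial x N k (w - j) (i %% N ^ k)) <= ((w - j) * m).+1)%N.
  apply: IH; [by move=> l /leqW; apply: hx | |].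
    by rewrite leq_subRL // (leq_trans _ hw) // mulSn leq_add2r ltnW.
  by rewrite ltn_mod.
have := msizeM_bound h1 h2; rewrite mulnBl subnKC //.
by rewrite leq_mul2r jw orbT.
Qed.

Lemma card_bmultinom_le d b : (#|{: 'X_{1..d < b.+1}}| <= b.+1 ^ d)%N.
Proof.
have -> : (b.+1 ^ d = #|{ffun 'I_d -> 'I_b.+1}|)%N by rewrite card_ffun !card_ord.
pose f (m : 'X_{1..d < b.+1}) := [ffun k : 'I_d => inord (m k) : 'I_b.+1].
apply: (@leq_card _ _ f) => m1 m2 /ffunP e; apply/val_inj/mnmP => k.
have H (m : 'X_{1..d < b.+1}) : (m k < b.+1)%N.
  by apply: leq_ltn_trans (bmdeg m); rewrite mdegE (bigD1 k) //= leq_addr.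
by have := congr1 val (e k); rewrite !ffunE /= !inordK.
Qed.

(** There are [N ^ e] monomials with exponents below [N] in [e] polynomials of
degree at most [m], and they lie in a space of dimension at most
[(e * N * m).+1 ^ d]; for [d < e] and large [N] the first number is bigger. *)
Lemma algebraic_dependence (K : fieldType) d e (x : nat -> {mpoly K[d]}) :
  (d < e)%N -> exists N (c : nat -> K),
  [/\ (0 < N)%N, exists2 i, (i < N ^ e)%N & c i != 0 &
   \sum_(0 <= i < N ^ e) (c i)%:MP * digit_monomial x N e (e * N) i = 0].
Proof.
move=> de; pose m := (\max_(j < e.+1) msize (x j))%N.
have hm j : (j <= e)%N -> (msize (x j) <= m.+1)%N.
  move=> je; apply: leqW.
  by have := @leq_bigmax _ (fun j : 'I_e.+1 => msize (x j)) (inord j); rewrite inordK.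
(* [N * (e * m).+1] bounds [e * N * m], so [N > (e * m).+1 ^ d] suffices. *)
pose N := ((e * m).+1 ^ d).+1; pose b := (e * N * m)%N.
have hb : (b.+1 ^ d < N ^ e)%N.
  apply: (@leq_ltn_trans ((N * (e * m).+1) ^ d)).
    case: (d) => // d'; rewrite leq_exp2r // /b mulnS mulnCA mulnA.
    by rewrite -addn1 addnC leq_add2r.
  rewrite expnMn; apply: (@leq_trans (N ^ d.+1)).
    by rewrite expnSr ltn_pmul2l ?expn_gt0.
  exact: leq_pexp2l.
pose A := \matrix_(i < N ^ e, j < #|{: 'X_{1..d < b.+1}}|)
   (digit_monomial x N e (e * N) i)@_(enum_val j : 'X_{1..d}).
have : kermx A != 0.
  rewrite kermx_eq0 /row_free neq_ltn; apply/orP; left.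
  apply: leq_ltn_trans (rank_leq_col _) (leq_ltn_trans (card_bmultinom_le _ _) hb).
case/rowV0Pn => v /sub_kermxP vA v0.
exists N, (fun i => if insub i is Some i' then v 0 i' else 0); split=> //.
  case/rV0Pn: v0 => i vi; exists i; first exact: ltn_ord.
  by rewrite insubT ?ltn_ord // => hi; rewrite (_ : Sub _ _ = i) //; apply: val_inj.
apply/mpolyP => mm; rewrite mcoeff0 raddf_sum /= big_mkord.
have [hmm|hmm] := leqP b.+1 (mdeg mm).
  rewrite big1 // => i _; rewrite mcoeffCM; apply/eqP; rewrite mulf_eq0.
  apply/orP; right; rewrite mcoeff_eq0; apply: msize_mdeg_ge.
  exact: leq_trans (msize_digit_monomial hm _ (ltn_ord i)) hmm.
have := congr1 (fun B : 'rV_ _ => B 0 (enum_rank (BMultinom hmm))) vA.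
rewrite !mxE => E; rewrite -[RHS]E; apply: eq_bigr => i _.
by rewrite mcoeffCM valK mxE enum_rankK.
Qed.

(** * Multihomogeneous forms *)

Section Multihomogeneous.
Variables (K : fieldType) (h n : nat).
Local Notation pol := {mpoly K[#|coord_index h n|]}.
Implicit Types (f g : pol) (D : 'I_n -> nat).

(** Unlike [multihomogeneous], this fixes the degree vector, so that forms of the
same multidegree can be added. *)
Definition multidegree D f := forall m, m \in msupp f ->
  forall i, (\sum_(ab : plucker_index h) m (enum_rank (i, ab)))%N = D i.

(** The coordinate vector indexed by [coord_index], from one vector for each
factor of the product. *)
Definition flat (A : Type) (q : 'I_n -> plucker_index h -> A)
    (k : 'I_#|coord_index h n|) : A :=
  q (enum_val k).1 (enum_val k).2.

Lemma coordsE (p : gr_prod K h n) : coords p =1 flat (fun i => @plucker K h (p i)).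
Proof. by move=> k; rewrite /coords /flat; case: (enum_val k). Qed.

Lemma multidegree0 D : multidegree D 0.
Proof. by move=> m; rewrite msupp0. Qed.

Lemma multidegreeC c : multidegree (fun=> 0%N) c%:MP.
Proof.
move=> m /msize_mdeg_lt; rewrite msizeC => hm i.
have /eqP : mdeg m = 0%N by case: eqP hm => //; lia.
by rewrite mdeg_eq0 => /eqP ->; apply: big1 => ab _; rewrite mnm0E.
Qed.

Lemma multidegreeX i ab :
  multidegree (fun j => (j == i) : nat) 'X_(enum_rank (i, ab)).
Proof.
move=> m; rewrite msuppX inE => /eqP -> j.
under eq_bigr do rewrite mnm1E (inj_eq enum_rank_inj) xpair_eqE eq_sym.
case: eqP => [_|ne] /=; last by rewrite big1.
rewrite (bigD1 ab) //= eqxx big1 // => ab' /negbTE; by rewrite eq_sym => ->.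
Qed.

Lemma multidegreeD D f g :
  multidegree D f -> multidegree D g -> multidegree D (f + g).
Proof.
by move=> hf hg m /msuppD_le; rewrite mem_cat => /orP[/hf|/hg].
Qed.

Lemma multidegree_sum D (I : Type) (r : seq I) (P : pred I) (F : I -> pol) :
  (forall i, P i -> multidegree D (F i)) -> multidegree D (\sum_(i <- r | P i) F i).
Proof.
move=> hF; elim/big_ind: _ => //; [exact: multidegree0|exact: multidegreeD].
Qed.

Lemma multidegreeM D E f g : multidegree D f -> multidegree E g ->
  multidegree (fun i => D i + E i)%N (f * g).
Proof.
move=> hf hg m /msuppM_le/allpairsP[[m1 m2] /= [/hf h1 /hg h2 ->]] i.
by under eq_bigr do rewrite mnmDE; rewrite big_split /= h1 h2.
Qed.

Lemma eq_multidegree D E f : D =1 E -> multidegree D f -> multidegree E f.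
Proof. by move=> e hf m /hf h1 i; rewrite h1. Qed.

Lemma multidegreeZ D c f : multidegree D f -> multidegree D (c%:MP * f).
Proof. by move=> /(multidegreeM (multidegreeC (c := c))); apply: eq_multidegree. Qed.

Lemma multidegreeXn D f w : multidegree D f ->
  multidegree (fun i => w * D i)%N (f ^+ w).
Proof.
move=> hf; elim: w => [|w IH]; first exact: multidegreeC.
by rewrite exprS; apply: eq_multidegree (multidegreeM hf IH) => i; rewrite mulSn.
Qed.

Lemma multidegree_prod (I : Type) (r : seq I) (D : I -> 'I_n -> nat) (F : I -> pol) :
  (forall i, multidegree (D i) (F i)) ->
  multidegree (fun j => \sum_(i <- r) D i j)%N (\prod_(i <- r) F i).
Proof.
move=> hF; elim: r => [|i r IH].
  by rewrite big_nil; apply: eq_multidegree (multidegreeC (c := 1)) => j; rewrite big_nil.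
rewrite big_cons; apply: eq_multidegree (multidegreeM (hF i) IH) => j.
by rewrite big_cons.
Qed.

(** This is what makes the vanishing of a form independent of the choice of
Pluecker coordinates in each factor. *)
Lemma multidegree_scale D f (lam : 'I_n -> K) (q q' : 'I_n -> plucker_index h -> K) :
  multidegree D f -> (forall i ab, q' i ab = lam i * q i ab) ->
  f.@[flat q'] = (\prod_i lam i ^+ D i) * f.@[flat q].
Proof.
move=> hf hq; rewrite !mevalE mulr_sumr big_seq [RHS]big_seq.
apply: eq_bigr => m /hf hm; rewrite mulrCA; congr (_ * _).
transitivity (\prod_i lam i ^+ D i *
              \prod_(k < #|coord_index h n|) flat q k ^+ m k) => //.
have reindexI (F : 'I_#|coord_index h n| -> K) :
    \prod_k F k = \prod_i \prod_ab F (enum_rank (i, ab)).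
  rewrite pair_big (reindex (@enum_rank (coord_index h n))) /=; last first.
    by exists enum_val => x _; rewrite ?enum_rankK ?enum_valK.
  by apply: eq_bigr => -[].
rewrite !reindexI -big_split; apply: eq_bigr => i _ /=.
rewrite -(hm i) expr_sum -big_split; apply: eq_bigr => ab _ /=.
by rewrite /flat !enum_rankK hq exprMn.
Qed.

Lemma multidegree_digit_monomial D (x : nat -> pol) N k w i :
  (forall j, (j <= k)%N -> multidegree D (x j)) ->
  (k * N <= w)%N -> (i < N ^ k)%N ->
  multidegree (fun j => w * D j)%N (digit_monomial x N k w i).
Proof.
elim: k w i => [|k IH] w i hx hw hi /=; first exact/multidegreeXn/hx.
have Nk : (0 < N ^ k)%N by rewrite expn_gt0; case: (N) hi => //; rewrite exp0n.
set j := (i %/ N ^ k)%N.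
have hj : (j < N)%N by rewrite ltn_divLR // -expnS.
have jw : (j <= w)%N.
  by rewrite (leq_trans (ltnW hj)) // (leq_trans _ hw) // mulSn leq_addr.
have h2 : multidegree (fun l => (w - j) * D l)%N
    (digit_monomial x N k (w - j) (i %% N ^ k)).
  apply: IH; [by move=> l /leqW; apply: hx | |by rewrite ltn_mod].
  by rewrite leq_subRL // (leq_trans _ hw) // mulSn leq_add2r ltnW.
have h3 := multidegreeM (multidegreeXn (w := j) (hx k.+1 (leqnn _))) h2.
apply: (eq_multidegree _ h3) => l; by rewrite -mulnDl subnKC.
Qed.

End Multihomogeneous.

Lemma rmorph_mmap (K : fieldType) N (A : comNzRingType) (iota : {rmorphism K -> A})
    (ev : {rmorphism A -> K}) (q : 'I_N -> A) (f : {mpoly K[N]}) :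
  cancel iota ev -> ev (mmap iota q f) = f.@[fun k => ev (q k)].
Proof.
move=> evK; rewrite mevalE /mmap rmorph_sum; apply: eq_bigr => m _.
rewrite rmorphM evK /mmap1 rmorph_prod; congr (_ * _).
by apply: eq_bigr => k _; rewrite rmorphXn.
Qed.

(** * Closed and irreducible sets *)

Section Zariski.
Variables (K : fieldType) (h n : nat).
Local Notation pol := {mpoly K[#|coord_index h n|]}.
Local Notation points := (gr_prod K h n).
Implicit Types (f g : pol) (D : 'I_n -> nat) (Z A B : set points).

Definition vanishes f Z := forall p, Z p -> f.@[coords p] = 0.

Lemma closed_zeros D f : multidegree D f ->
  zariski_closed [set p : points | f.@[coords p] = 0].
Proof.
move=> hf; exists [set f]; split=> [_ -> |]; first by exists D.
by apply/seteqP; split=> p /=; [move=> h1 _ -> | apply].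
Qed.

Lemma closed_separate Z p : zariski_closed Z -> ~ Z p ->
  exists D f, [/\ multidegree D f, vanishes f Z & f.@[coords p] != 0].
Proof.
case=> S [hS ->] /existsNP[f /not_implyP[Sf /eqP fp]].
have [D hD] := hS f Sf; by exists D, f; split=> // q; apply.
Qed.

(** The forms vanishing on a set cut out its closure. *)
Lemma closed_closure A : zariski_closed (zariski_closure A).
Proof.
exists [set f | multihomogeneous f /\ vanishes f A]; split=> [f []//|].
apply/seteqP; split=> [p hp f [[D hf] fA] | p hp Z [[S [hS ->]] AS] f Sf].
  exact: (hp [set q | f.@[coords q] = 0] (conj (closed_zeros hf) fA)).
by apply: hp; split; [exact: hS | move=> q /AS /(_ f Sf)].
Qed.

Lemma sub_closure A : A `<=` zariski_closure A.
Proof. by move=> p Ap Z [_]; apply. Qed.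

Lemma closure_sub A Z : zariski_closed Z -> A `<=` Z -> zariski_closure A `<=` Z.
Proof. by move=> cZ AZ p; apply. Qed.

Lemma vanishes_closure D f A : multidegree D f -> vanishes f A ->
  vanishes f (zariski_closure A).
Proof. by move=> hf fA; exact: (closure_sub (closed_zeros hf)). Qed.

Lemma irreducible_vanishesM Z D E f g : irreducible_set Z ->
  multidegree D f -> multidegree E g -> vanishes (f * g) Z ->
  vanishes f Z \/ vanishes g Z.
Proof.
move=> [_ irrZ] hf hg fg.
apply: (irrZ _ _ (closed_zeros hf) (closed_zeros hg)) => p /fg /eqP.
by rewrite mevalM mulf_eq0 => /orP[] /eqP; [left|right].
Qed.

Lemma irreducible_vanishesX Z D f w : irreducible_set Z -> multidegree D f ->
  vanishes (f ^+ w) Z -> vanishes f Z.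
Proof.
move=> irrZ hf; elim: w => [|w IH].
  by case: irrZ => -[p Zp] _ /(_ p Zp) /eqP; rewrite rmorph1 oner_eq0.
rewrite exprS => /(irreducible_vanishesM irrZ hf (multidegreeXn (w := w) hf)).
by case=> // /IH.
Qed.

Lemma irreducible_vanishes_prod Z (I : eqType) (r : seq I) (D : I -> 'I_n -> nat)
    (F : I -> pol) :
  irreducible_set Z -> (forall i, multidegree (D i) (F i)) ->
  vanishes (\prod_(i <- r) F i) Z -> exists2 i, i \in r & vanishes (F i) Z.
Proof.
move=> irrZ hF; elim: r => [|i r IH].
  case: irrZ => -[p Zp] _ /(_ p Zp) /eqP.
  by rewrite big_nil rmorph1 oner_eq0.
rewrite big_cons => /(irreducible_vanishesM irrZ (hF i) (multidegree_prod (r := r) hF)).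
case=> [h1|/IH[j jr hj]]; first by exists i; rewrite ?mem_head.
by exists j; rewrite // inE jr orbT.
Qed.

(** The relation is factored as a power of [x k] times a second factor whose
restriction to [Z k.-1], where [x k] vanishes, is a relation of the same kind
in one variable less.  By irreducibility of [Z k] the second factor would have
to vanish on [Z k] along with the whole relation. *)
Lemma chain_independent (Z : nat -> set points) (x : nat -> pol) D N e :
  (0 < N)%N ->
  (forall k, (k <= e)%N -> irreducible_set (Z k)) ->
  (forall k, (k < e)%N -> Z k `<=` Z k.+1) ->
  (forall k, (k <= e)%N -> multidegree D (x k)) ->
  (forall k, (k <= e)%N -> ~ vanishes (x k) (Z k)) ->
  (forall k, (k < e)%N -> vanishes (x k.+1) (Z k)) ->
  forall k w (c : nat -> K), (k <= e)%N -> (k * N <= w)%N ->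
    (exists2 i, (i < N ^ k)%N & c i != 0) ->
    ~ vanishes (\sum_(0 <= i < N ^ k) (c i)%:MP * digit_monomial x N k w i) (Z k).
Proof.
move=> N0 irrZ subZ hx xZ x0; elim=> [|k IH] w c ke hw [i hi ci].
  move: hi ci; rewrite expn0 ltnS leqn0 => /eqP -> c0.
  rewrite big_nat1 /= => h0; apply: (xZ 0%N ke).
  apply: (irreducible_vanishesX (w := w) (irrZ _ ke) (hx _ ke)) => p /h0 /eqP.
  by rewrite mevalM mevalC mulf_eq0 (negbTE c0) => /eqP.
(* [nz j]: the coefficient of [x k.+1 ^+ j] is a nonzero relation. *)
pose nz j := [exists l : 'I_(N ^ k), c (j * N ^ k + l)%N != 0].
have Nk : (0 < N ^ k)%N by rewrite expn_gt0 N0.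
have ex_nz : exists j, nz j.
  exists (i %/ N ^ k)%N; apply/existsP; exists (Ordinal (ltn_pmod i Nk)).
  by rewrite /= -divn_eq.
case: (ex_minnP ex_nz) => j0 /existsP[l cl] j0min.
have j0N : (j0 < N)%N.
  apply: (@leq_ltn_trans (i %/ N ^ k)%N).
    apply: j0min; apply/existsP; exists (Ordinal (ltn_pmod i Nk)).
    by rewrite /= -divn_eq.
  by rewrite ltn_divLR // -expnS.
pose S j := \sum_(0 <= i < N ^ k)
   (c (j * N ^ k + i)%N)%:MP * digit_monomial x N k (w - j) i.
have hS j : (j < N)%N -> multidegree (fun l => (w - j) * D l)%N (S j).
  move=> jN; rewrite /S big_nat_cond; apply: multidegree_sum => i'.
  rewrite andbT => /andP[_ hi']; apply: multidegreeZ.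
  apply: multidegree_digit_monomial => //.
    by move=> j' /leqW j'k; apply: hx; apply: leq_trans ke.
  by rewrite leq_subRL; move: hw; rewrite mulSn; lia.
rewrite (digit_monomial_split _ _ _ (fun i => (c i)%:MP) N0).
rewrite (@big_cat_nat _ _ _ j0 0 N) ?(ltnW j0N) //= big_nat_cond big1 ?add0r; last first.
  move=> j /andP[/andP[_ jj0] _]; rewrite big_nat_cond big1 ?mulr0 // => i'.
  rewrite andbT => /andP[_ hi'].
  have : ~~ nz j by apply/negP => /j0min; rewrite leqNgt jj0.
  rewrite negb_exists => /forallP/(_ (Ordinal hi')) /=; rewrite negbK => /eqP ->.
  by rewrite mpolyC0 mul0r.
pose T := \sum_(j0.+1 <= j < N) x k.+1 ^+ (j - j0.+1) * S j.
rewrite big_ltn // (_ : \sum_(j0.+1 <= _ < N) _ = x k.+1 ^+ j0 * (x k.+1 * T)); last first.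
  rewrite mulrA -exprSr /T mulr_sumr big_nat_cond [RHS]big_nat_cond.
  apply: eq_bigr => j; rewrite andbT => /andP[hj _].
  by rewrite mulrA -exprD subnKC.
rewrite -/(S j0) -mulrDr => van.
have wj0 : (j0 < w)%N by move: hw; rewrite mulSn; lia.
have hT : multidegree (fun l => (w - j0.+1) * D l)%N T.
  rewrite /T big_nat_cond; apply: multidegree_sum => j.
  rewrite andbT => /andP[hj jN].
  apply: eq_multidegree (multidegreeM (multidegreeXn (w := j - j0.+1) (hx _ ke)) (hS j jN)).
  move=> l'; rewrite -mulnDl; congr (_ * _)%N.
  by move: hw; rewrite mulSn; lia.
have hxT : multidegree (fun l => (w - j0) * D l)%N (S j0 + x k.+1 * T).
  apply: multidegreeD; first exact: hS.
  apply: eq_multidegree (multidegreeM (hx _ ke) hT) => l'.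
  by rewrite -mulSn; congr (_ * _)%N; lia.
have := irreducible_vanishesM (irrZ _ ke) (multidegreeXn (w := j0) (hx _ ke)) hxT van.
case=> [/(irreducible_vanishesX (irrZ _ ke) (hx _ ke))|]; first exact: xZ.
move=> van2; apply: (IH (w - j0)%N (fun i => c (j0 * N ^ k + i)%N) (ltnW ke)).
- by move: hw; rewrite mulSn; lia.
- by exists l.
move=> p Zp; have := van2 p (subZ _ ke _ Zp).
by rewrite mevalD mevalM (x0 _ ke _ Zp) mul0r addr0.
Qed.

End Zariski.

(** * Lines as column spans *)

Definition minor (A : pzRingType) m (M : 'M[A]_(m, 2)) (a b : 'I_m) : A :=
  M a 0 * M b 1 - M b 0 * M a 1.

Lemma map_minor (A B : pzRingType) (phi : {rmorphism A -> B}) m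
    (M : 'M[A]_(m, 2)) a b :
  minor (map_mx phi M) a b = phi (minor M a b).
Proof. by rewrite /minor rmorphB !rmorphM !mxE. Qed.

Lemma sum_ord2 (V : nmodType) (F : 'I_2 -> V) : \sum_i F i = F 0 + F 1.
Proof.
by rewrite big_ord_recl big_ord1; congr (_ + F _); apply: val_inj.
Qed.

Section ColumnSpan.
Variable K : fieldType.

Definition colspan m (M : 'M[K]_(m, 2)) : {vspace 'cV[K]_m} :=
  limg (linfun (mulmx M)).

Lemma memv_colspanP m (M : 'M[K]_(m, 2)) (x : 'cV[K]_m) :
  reflect (exists w : 'cV[K]_2, x = M *m w) (x \in colspan M).
Proof.
apply: (iffP memv_imgP) => [[w _ ->]|[w ->]]; first by exists w; rewrite lfunE.
by exists w; rewrite ?memvf // lfunE.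
Qed.

Lemma camera_map_colspan h (C : 'M[K]_(h.+1, 4)) (M : 'M[K]_(4, 2)) :
  (camera_map C @: colspan M)%VS = colspan (C *m M).
Proof.
rewrite /colspan -limg_comp; congr (_ @: _)%VS; apply/lfunP => w.
by rewrite comp_lfunE !lfunE /= mulmxA.
Qed.

Lemma dim_colspan m (M : 'M[K]_(m, 2)) :
  (forall w : 'cV[K]_2, M *m w = 0 -> w = 0) <-> \dim (colspan M) = 2%N.
Proof.
rewrite /colspan; set f : 'Hom('cV[K]_2, 'cV[K]_m) := linfun (mulmx M).
have fE w : f w = M *m w by rewrite lfunE.
have := limg_ker_dim f fullv; rewrite capfv dimvf dim_matrix => E.
split=> [inj | d2].
  have k0 : lker f == 0%VS.
    rewrite -subv0; apply/subvP => w.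
    by rewrite memv_ker fE => /eqP/inj ->; rewrite mem0v.
  by move: E; rewrite (eqP k0) dimv0.
move: E; rewrite d2 => E w Mw; apply/eqP; rewrite -memv0.
have /eqP : \dim (lker f) = 0%N by move: E; lia.
by rewrite dimv_eq0 => /eqP <-; rewrite memv_ker fE Mw.
Qed.

Lemma colsE m (M : 'M[K]_(m, 2)) (w : 'cV[K]_2) b :
  (M *m w) b 0 = M b 0 * w 0 0 + M b 1 * w 1 0.
Proof. by rewrite mxE sum_ord2. Qed.

Lemma col2P (w w' : 'cV[K]_2) : w 0 0 = w' 0 0 -> w 1 0 = w' 1 0 -> w = w'.
Proof.
move=> e0 e1; apply/colP => -[[|[|//]] hi].
  by rewrite (_ : Ordinal hi = 0) //; apply: val_inj.
by rewrite (_ : Ordinal hi = 1) //; apply: val_inj.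
Qed.

Lemma minor_neq0_inj m (M : 'M[K]_(m, 2)) a b : minor M a b != 0 ->
  forall w : 'cV[K]_2, M *m w = 0 -> w = 0.
Proof.
rewrite /minor => mab w /colP Mw.
have := Mw a; have := Mw b; rewrite !colsE !mxE => hb ha.
apply: col2P; rewrite mxE; apply/eqP; rewrite -(mulrI_eq0 _ (mulfI mab)); apply/eqP.
  transitivity ((M a 0 * w 0 0 + M a 1 * w 1 0) * M b 1 -
    (M b 0 * w 0 0 + M b 1 * w 1 0) * M a 1); first by ring.
  by rewrite ha hb; ring.
transitivity ((M b 0 * w 0 0 + M b 1 * w 1 0) * M a 0 -
    (M a 0 * w 0 0 + M a 1 * w 1 0) * M b 0); first by ring.
by rewrite ha hb; ring.
Qed.

(** If all the minors vanish, each row [a] of the matrix provides an element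
[(M a 1, - M a 0)] of the kernel. *)
Lemma minor_neq0_ex m (M : 'M[K]_(m, 2)) :
  (forall w : 'cV[K]_2, M *m w = 0 -> w = 0) ->
  exists a b : 'I_m, (a < b)%N /\ minor M a b != 0.
Proof.
move=> inj; apply: contrapT => none.
have m0 a b : minor M a b = 0.
  apply/eqP/negP => /negP mab; apply: none.
  have [ab|ba|/val_inj e] := ltngtP a b; first by exists a, b.
    exists b, a; split=> //; apply: contraNneq mab => e.
    suff -> : minor M a b = - minor M b a by rewrite e oppr0.
    by rewrite /minor; ring.
  by move: mab; rewrite e /minor subrr eqxx.
pose w a : 'cV[K]_2 := \col_i (if i == 0 then M a 1 else - M a 0).
have M0 a : M a 0 = 0 /\ M a 1 = 0.
  have /inj/colP Mw : M *m w a = 0.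
    apply/colP => b; rewrite colsE !mxE /= -[RHS](m0 b a) /minor; ring.
  have := Mw 0; have := Mw 1; rewrite !mxE /= => e1 e0; split=> //.
  by rewrite -[LHS]opprK e1 oppr0.
have /inj/colP/(_ 0) : M *m (const_mx 1 : 'cV_2) = 0.
  by apply/colP => b; rewrite colsE !mxE; have [-> ->] := M0 b; ring.
by rewrite !mxE => /eqP; rewrite oner_eq0.
Qed.

Definition basis_mx m (E : {vspace 'cV[K]_m}) : 'M[K]_(m, 2) :=
  \matrix_(i < m, j < 2) (vbasis E)`_j i 0.

Lemma colspan_vbasis m (E : {vspace 'cV[K]_m}) : \dim E = 2%N ->
  E = colspan (basis_mx E).
Proof.
move=> d2; set M := basis_mx E.
have mulM w : M *m w = w 0 0 *: (vbasis E)`_0 + w 1 0 *: (vbasis E)`_1.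
  by apply/colP => i; rewrite colsE !mxE; ring.
apply/vspaceP => x; rewrite -{1}(span_basis (vbasisP E)); apply/idP/memv_colspanP.
  move/coord_span => ->.
    exists (\col_i coord (vbasis E) (cast_ord (esym d2) i) x); rewrite mulM !mxE.
  rewrite (reindex (cast_ord (esym d2))) /=; last first.
    by exists (cast_ord d2) => i _; rewrite ?cast_ordK ?cast_ordKV.
  by rewrite sum_ord2.
case=> w ->; rewrite mulM rpredD // rpredZ // memv_span // mem_nth // size_tuple d2 //.
Qed.

Lemma exists_colspan m (E : {vspace 'cV[K]_m}) : \dim E = 2%N ->
  exists M : 'M[K]_(m, 2), E = colspan M.
Proof. by move=> /colspan_vbasis; exists (basis_mx E). Qed.

Lemma pluckerE h (E : Gr1 K h) ab :
  plucker E ab =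
  minor (basis_mx E) (val ab).1 (val ab).2.
Proof. by rewrite /plucker; case: (val ab) => a b; rewrite /minor !mxE. Qed.

Lemma plucker_ex h (E : Gr1 K h) : exists ab, plucker E ab != 0.
Proof.
have d2 := eqP (dim_line_vs E).
have := d2; rewrite {1}(colspan_vbasis d2) => /dim_colspan/minor_neq0_ex[a [b [ab hab]]].
exists (exist _ (a, b) ab); rewrite pluckerE; exact: hab.
Qed.

(** The change of basis multiplies all the minors by its determinant, which is
nonzero because some Pluecker coordinate is. *)
Lemma plucker_colspan h (E : Gr1 K h) M : line_vs E = colspan M ->
  exists2 lam : K, lam != 0 &
    forall ab, plucker E ab = lam * minor M (val ab).1 (val ab).2.
Proof.
move=> EM; have d2 := eqP (dim_line_vs E).
have EB := colspan_vbasis d2; set B := basis_mx E in EB.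
have hcol j : col j B \in colspan M.
  rewrite -EM EB; apply/memv_colspanP; exists (delta_mx j 0).
  by rewrite colE.
have [W hW] : exists W : 'M[K]_2, B = M *m W.
  have [w0 h0] := memv_colspanP _ _ (hcol 0).
  have [w1 h1] := memv_colspanP _ _ (hcol 1).
  exists (\matrix_(i, j) if j == 0 then w0 i 0 else w1 i 0).
  apply/matrixP => i j; have hj : j = 0 \/ j = 1.
    by case: j => -[|[|//]] hj; [left|right]; apply: val_inj.
  case: hj => ->.
    move/colP/(_ i): h0; rewrite !mxE => ->; apply: eq_bigr => k _; by rewrite !mxE.
  move/colP/(_ i): h1; rewrite !mxE => ->; apply: eq_bigr => k _; by rewrite !mxE.
have WE i j : B i j = M i 0 * W 0 j + M i 1 * W 1 j.
  by rewrite hW mxE sum_ord2.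
have mE ab : plucker E ab = minor W 0 1 * minor M (val ab).1 (val ab).2.
  by rewrite pluckerE -/B /minor !WE; ring.
exists (minor W 0 1) => //; apply/eqP => w0.
by have [ab] := plucker_ex E; rewrite mE w0 mul0r eqxx.
Qed.

Lemma line_of_colspan h (M : 'M[K]_(h.+1, 2)) :
  (forall w : 'cV[K]_2, M *m w = 0 -> w = 0) ->
  exists E : Gr1 K h, line_vs E = colspan M.
Proof. by move=> /dim_colspan/eqP d2; exists (Line d2). Qed.

End ColumnSpan.

(** * Chains in the closure of a parametrized set *)

Section UpperBound.
Variables (K : fieldType) (h n : nat).
Local Notation pol := {mpoly K[#|coord_index h n|]}.
Local Notation points := (gr_prod K h n).

(** A product of coordinates, one from each factor; it does not vanish on the
affine chart where the chosen coordinates are nonzero, and serves to adjust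
multidegrees. *)
Definition chart_monomial (ab : 'I_n -> plucker_index h) (D : 'I_n -> nat) : pol :=
  \prod_i 'X_(enum_rank (i, ab i)) ^+ D i.

Lemma multidegree_chart_monomial ab D : multidegree D (chart_monomial ab D).
Proof.
have := multidegree_prod (r := index_enum 'I_n)
  (fun i => multidegreeXn (w := D i) (multidegreeX (K := K) (i := i) (ab := ab i))).
apply: eq_multidegree => j; rewrite (bigD1 j) //= eqxx muln1 big1 ?addn0 // => i.
by rewrite eq_sym => /negbTE ->; rewrite muln0.
Qed.

Lemma chart_monomial_neq0 ab D (p : points) :
  (forall i, plucker (p i) (ab i) != 0) -> (chart_monomial ab D).@[coords p] != 0.
Proof.
move=> hp; rewrite rmorph_prod; apply/prodf_neq0 => i _.
by rewrite rmorphXn /= expf_neq0 // mevalXU coordsE /flat enum_rankK.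
Qed.

(** Forms witnessing that a chain is strict, multiplied by powers of
coordinates that do not vanish at a point of [Z 0] in order to get a common
multidegree. *)
Lemma chain_forms (Z : nat -> set points) e :
  (forall i, (i <= e)%N -> zariski_closed (Z i) /\ irreducible_set (Z i)) ->
  (forall i, (i < e)%N -> Z i `<` Z i.+1) ->
  exists D (x : nat -> pol),
  [/\ forall k, (k <= e)%N -> multidegree D (x k),
      forall k, (k <= e)%N -> ~ vanishes (x k) (Z k) &
      forall k, (k < e)%N -> vanishes (x k.+1) (Z k)].
Proof.
move=> hZ ltZ.
have [Df hDf] : {Df : nat -> ('I_n -> nat) * pol & forall k, (k < e)%N ->
    [/\ multidegree (Df k).1 (Df k).2, vanishes (Df k).2 (Z k) &
        ~ vanishes (Df k).2 (Z k.+1)]}.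
  pose P k (Df : ('I_n -> nat) * pol) := (k < e)%N ->
    [/\ multidegree Df.1 Df.2, vanishes Df.2 (Z k) & ~ vanishes Df.2 (Z k.+1)].
  apply: (@choice _ _ P) => k; rewrite /P.
  have [ke|] := ltnP k e; last by exists ((fun=> 0%N), 0).
  have [_ /existsNP[p /not_implyP[Zp nZp]]] := ltZ k ke.
  have [D [f [hf f0 fp]]] := closed_separate (hZ k (ltnW ke)).1 nZp.
  by exists (D, f) => _; split=> // /(_ p Zp)/eqP; rewrite (negbTE fp).
have [p Z0p] : Z 0%N !=set0 := (hZ 0%N (leq0n _)).2.1.
have Zp k : (k <= e)%N -> Z k p.
  elim: k => // k IH ke; have [sub _] := ltZ k ke; exact/sub/IH/ltnW.
have [ab hab] := fin_all_exists (fun i => plucker_ex (p i)).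
(* The sum of the multidegrees of all the forms is above each of them. *)
pose D i := (\sum_(k < e) (Df k).1 i)%N.
pose x k := if k is k'.+1
  then (Df k').2 * chart_monomial ab (fun i => D i - (Df k').1 i)%N
  else chart_monomial ab D.
have chart0 E k : (k <= e)%N -> ~ vanishes (chart_monomial ab E) (Z k).
  by move=> /Zp pZ /(_ p pZ) /eqP; rewrite (negbTE (chart_monomial_neq0 _ hab)).
exists D, x; split=> [[|k] ke|[|k] ke|k ke] /=.
- exact: multidegree_chart_monomial.
- have [hf _ _] := hDf k ke.
  have hm := multidegreeM hf
    (@multidegree_chart_monomial ab (fun i => D i - (Df k).1 i)%N).
  apply: (eq_multidegree _ hm) => i.
  by rewrite subnKC // /D (bigD1 (Ordinal ke)) //= leq_addr.
- exact: chart0.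
- have [hf _ nf] := hDf k ke.
  have hm := @multidegree_chart_monomial ab (fun i => D i - (Df k).1 i)%N.
  case/(irreducible_vanishesM (hZ _ ke).2 hf hm) => //; exact: chart0.
- have [_ f0 _] := hDf k ke => q /f0 fq.
  by rewrite mevalM fq mul0r.
Qed.

(** The index [a] selects one of finitely many charts, so no single
parametrization has to reach all of [X].  The product over the charts of the
relations given by [algebraic_dependence] vanishes on [X], hence on the last
member of the chain, and irreducibility singles out one chart. *)
Theorem chain_length_le (d : nat) (I : finType)
    (U : I -> 'I_n -> plucker_index h -> {mpoly K[d]}) (X : set points) :
  (forall p, X p -> exists a t (lam : 'I_n -> K),
     forall i ab, plucker (p i) ab = lam i * (U a i ab).@[t]) ->
  forall e Z, irreducible_chain (zariski_closure X) e Z -> (e <= d)%N.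
Proof.
move=> hX e Z [hZ ltZ]; rewrite leqNgt; apply/negP => de.
have [i le_ie|D [x [hx nx x0]]] := @chain_forms Z e _ ltZ.
  by have [] := hZ i le_ie.
pose phi a : {rmorphism pol -> {mpoly K[d]}} := mmap (@mpolyC d K) (flat (U a)).
have [N hN] := fin_all_exists (fun a => algebraic_dependence (phi a \o x) de).
have [c hc] := fin_all_exists hN.
pose H a : pol := \sum_(0 <= i < N a ^ e)
  (c a i)%:MP * digit_monomial x (N a) e (e * N a) i.
have hH a : multidegree (fun i => e * N a * D i)%N (H a).
  rewrite /H big_nat_cond; apply: multidegree_sum => i.
  rewrite andbT => /andP[_ hi]; apply: multidegreeZ.
  exact: multidegree_digit_monomial.
have phiH a : phi a (H a) = 0.
  have [_ _ <-] := hc a; rewrite rmorph_sum; apply: eq_bigr => i _.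
  by rewrite rmorphM rmorph_digit_monomial /= mmapC.
have vanX : vanishes (\prod_a H a) X.
  move=> p /hX[a [t [lam hp]]].
  suff HE : (H a).@[coords p] = 0.
    by rewrite rmorph_prod; apply/eqP/prodf_eq0; exists a => //; apply/eqP.
  rewrite (meval_eq _ (@coordsE _ _ _ _)) (multidegree_scale (hH a) hp).
  have := congr1 (meval t) (phiH a); rewrite /phi /=.
  rewrite (rmorph_mmap (ev := meval t)) => [|y]; last exact: mevalC.
  by rewrite meval0 => E; rewrite [X in _ * X]E mulr0.
have Zvan : vanishes (\prod_a H a) (Z e).
  move=> p Zp; have [_ _ ZX] := hZ e (leqnn _).
  by apply: (vanishes_closure (multidegree_prod hH) vanX); exact: ZX.
have irrZ k : (k <= e)%N -> irreducible_set (Z k) by move=> /hZ[].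
have [a _] := irreducible_vanishes_prod (irrZ e (leqnn _)) hH Zvan.
have [N0 exc _] := hc a.
apply: (chain_independent N0 irrZ _ hx nx x0 (leqnn e) (leqnn _) exc) => k ke.
by have [] := ltZ k ke.
Qed.

End UpperBound.

Section UpperBoundLines.
Variables (K : fieldType) (h n : nat) (C : 'I_n -> 'M[K]_(h.+1, 4)).
Local Notation points := (gr_prod K h n).

Definition entry_poly d (o : option (option 'I_d)) : {mpoly K[d]} :=
  match o with None => 0 | Some None => 1 | Some (Some k) => 'X_k end.

Lemma parametrized_chain_le (d : nat) (X : set points) :
  (forall p, X p -> exists (M : 'M[K]_(4, 2)) (ts : seq K),
     [/\ size ts = d, forall a j, M a j \in [:: 0, 1 & ts] &
         forall i, line_vs (p i) = colspan (C i *m M)]) ->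
  forall e Z, irreducible_chain (zariski_closure X) e Z -> (e <= d)%N.
Proof.
move=> hX.
pose I : finType := {ffun 'I_4 * 'I_2 -> option (option 'I_d)}.
pose U (o : I) i (ab : plucker_index h) : {mpoly K[d]} :=
  minor (map_mx (@mpolyC d K) (C i) *m \matrix_(a, j) entry_poly (o (a, j)))
    (val ab).1 (val ab).2.
apply: (chain_length_le (U := U)) => p /hX[M [ts [sz hM hp]]].
pose t (k : 'I_d) := ts`_k.
have hsel aj : exists o, (entry_poly o).@[t] = M aj.1 aj.2.
  have := hM aj.1 aj.2; rewrite !inE => /orP[/eqP ->|/orP[/eqP ->|]].
  - by exists None; rewrite meval0.
  - by exists (Some None); rewrite meval1.
  move=> /(nthP 0)[k hk <-]; rewrite sz in hk.
  by exists (Some (Some (Ordinal hk))); rewrite mevalXU.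
have [o ho] := fin_all_exists hsel.
have [lam hlam] := fin_all_exists (fun i =>
  let: ex_intro2 lam _ H := plucker_colspan (hp i) in ex_intro _ lam H).
exists [ffun aj => o aj], t, lam => i ab; rewrite hlam /U -map_minor map_mxM.
congr (_ * minor (_ *m _) _ _); apply/matrixP => a j; rewrite !mxE.
  by rewrite /= mevalC.
by rewrite ffunE; have := ho (a, j) => /= ->.
Qed.

End UpperBoundLines.

(** * Chains from affine families of lines *)

Section LowerBound.
Variables (K : numFieldType) (h n : nat) (C : 'I_n -> 'M[K]_(h.+1, 4)).
Local Notation points := (gr_prod K h n).
Local Notation pol := {mpoly K[#|coord_index h n|]}.

(** One of the natural numbers below [size p] is not a root. *)
Lemma exists_nonroot (p : {poly K}) : p != 0 -> exists s, p.[s] != 0.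
Proof.
move=> p0; apply: contrapT => none.
suff: (size [seq (k%:R : K) | k <- iota 0 (size p)] < size p)%N.
  by rewrite size_map size_iota ltnn.
apply: max_poly_roots p0 _ _.
  apply/allP => _ /mapP[k _ ->]; rewrite rootE; apply/negP => /negP hk.
  by apply: none; exists k%:R.
by rewrite map_inj_uniq ?iota_uniq // => i j /eqP; rewrite eqr_nat => /eqP.
Qed.

Definition minors (M : 'M[K]_(4, 2)) (i : 'I_n) (ab : plucker_index h) : K :=
  minor (C i *m M) (val ab).1 (val ab).2.

(** The pictures of the lines spanned by matrices in [F]; as [p i] has
dimension 2, only lines missing all the centers contribute. *)
Definition camera_points (F : set 'M[K]_(4, 2)) : set points :=
  [set p | exists2 M, F M & forall i, line_vs (p i) = colspan (C i *m M)].

Definition affine_closed (F : set 'M[K]_(4, 2)) :=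
  forall M N s, F M -> F N -> F (M + s *: (N - M)).

Definition defined_at (M : 'M[K]_(4, 2)) :=
  forall i (w : 'cV[K]_2), C i *m M *m w = 0 -> w = 0.

Lemma camera_points_eval D (f : pol) (M : 'M[K]_(4, 2)) (p : points) :
  multidegree D f -> (forall i, line_vs (p i) = colspan (C i *m M)) ->
  (f.@[coords p] == 0) = (f.@[flat (minors M)] == 0).
Proof.
move=> hf hp.
have [lam hlam] := fin_all_exists (fun i =>
  let: ex_intro2 lam l0 H := plucker_colspan (hp i) in ex_intro _ lam (conj l0 H)).
rewrite (meval_eq _ (@coordsE _ _ _ _)).
rewrite (multidegree_scale (lam := lam) (q := minors M) hf) => [|i ab]; last first.
  by have [_ ->] := hlam i.
rewrite mulf_eq0; case: eqP => // /eqP; rewrite prodf_seq_eq0 => /hasP[i _].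
by rewrite /= expf_eq0; have [/negbTE -> _] := hlam i; rewrite andbF.
Qed.

Lemma camera_points_defined M (p : points) :
  (forall i, line_vs (p i) = colspan (C i *m M)) -> defined_at M.
Proof.
by move=> hp i; apply/dim_colspan; rewrite -hp; exact/eqP/dim_line_vs.
Qed.

(** On the line joining [M] to [N], the two forms and, for each camera, one
minor that is nonzero at [M] are nonzero polynomials of the parameter; the
line is sent to an honest point at any parameter where none of them vanishes. *)
Lemma generic_camera_point F D E (f g : pol) M N :
  affine_closed F -> F M -> F N -> defined_at M ->
  multidegree D f -> multidegree E g ->
  f.@[flat (minors M)] != 0 -> g.@[flat (minors N)] != 0 ->
  exists p, [/\ camera_points F p, f.@[coords p] != 0 & g.@[coords p] != 0].
Proof.
move=> aF FM FN dM hf hg fM gN.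
pose L s := M + s *: (N - M).
pose Q : 'M[{poly K}]_(4, 2) := map_mx polyC M + 'X *: map_mx polyC (N - M).
pose q i (ab : plucker_index h) :=
  minor (map_mx polyC (C i) *m Q) (val ab).1 (val ab).2.
have qE i ab s : (q i ab).[s] = minors (L s) i ab.
  rewrite -[LHS]/(horner_eval s _) -map_minor map_mxM.
  rewrite /minors; congr (minor (_ *m _) _ _).
    by apply/matrixP => a j; rewrite !mxE /= /horner_eval hornerC.
  by apply/matrixP => a j; rewrite !mxE /= /horner_eval !hornerE.
pose P (f' : pol) := mmap polyC (flat q) f'.
have PE f' s : (P f').[s] = f'.@[flat (minors (L s))].
  rewrite -[LHS]/(horner_eval s _) rmorph_mmap => [|y]; last exact: hornerC.
  by apply: meval_eq => k; exact: qE.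
have L0 : L 0 = M by rewrite /L scale0r addr0.
have L1 : L 1 = N by rewrite /L scale1r addrC subrK.
have exM i : exists ab : plucker_index h, minors M i ab != 0.
  have [a [b [lt_ab mab]]] := minor_neq0_ex (dM i).
  by exists (exist _ (a, b) lt_ab).
have [ab hab] := fin_all_exists exM.
have : P f * P g * \prod_i q i (ab i) != 0.
  have neq0 (r : {poly K}) s : r.[s] != 0 -> r != 0.
    by apply: contraNneq => ->; rewrite horner0.
  rewrite !mulf_neq0 //.
  - by apply: (neq0 _ 0); rewrite PE L0.
  - by apply: (neq0 _ 1); rewrite PE L1.
  by apply/prodf_neq0 => i _; apply: (neq0 _ 0); rewrite qE L0.
case/exists_nonroot => s; rewrite !hornerM horner_prod !mulf_eq0 !negb_or !PE.
case/andP => /andP[fs gs] /prodf_neq0 qs.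
have inj i := minor_neq0_inj (eq_rect _ (fun x => is_true (x != 0)) (qs i isT) _ (qE _ _ _)).
have [p hp] := fin_all_exists (fun i => line_of_colspan (inj i)).
exists p; split; first by exists (L s) => //; exact: aF.
  by rewrite (camera_points_eval hf hp).
by rewrite (camera_points_eval hg hp).
Qed.

Lemma irreducible_closure_camera_points F M : affine_closed F -> F M -> defined_at M ->
  irreducible_set (zariski_closure (camera_points F)).
Proof.
move=> aF FM dM; split.
  have [p hp] := fin_all_exists (fun i => line_of_colspan (dM i)).
  by exists p; apply: sub_closure; exists M.
move=> A B cA cB subAB; apply: contrapT => /not_orP[nA nB].
have ex_out Z : zariski_closed Z -> ~ zariski_closure (camera_points F) `<=` Z ->
    exists2 p, camera_points F p & ~ Z p.
  move=> cZ nZ; apply: contrapT => none; apply: nZ; apply: closure_sub => // p Fp.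
  by apply: contrapT => nZp; apply: none; exists p.
have [p [M1 FM1 hp] nAp] := ex_out A cA nA.
have [q [M2 FM2 hq] nBq] := ex_out B cB nB.
have [D [f [hf fA fp]]] := closed_separate cA nAp.
have [E [g [hg gB gq]]] := closed_separate cB nBq.
rewrite (camera_points_eval hf hp) in fp; rewrite (camera_points_eval hg hq) in gq.
have dM1 := camera_points_defined hp.
have [r [Fr fr gr]] := generic_camera_point aF FM1 FM2 dM1 hf hg fp gq.
case: (subAB r (sub_closure Fr)) => [/fA/eqP|/gB/eqP].
  by rewrite (negbTE fr).
by rewrite (negbTE gr).
Qed.

(** The value of [l] wedge [m] on the two columns of [M]; it vanishes when the
line spanned by these columns meets the line of common zeros of [l] and [m]. *)
Definition wedge (l m : 'rV[K]_4) (M : 'M[K]_(4, 2)) : K :=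
  (l *m M) 0 0 * (m *m M) 0 1 - (l *m M) 0 1 * (m *m M) 0 0.

(** The form whose value is the [(a, b)] minor of the [i]-th picture, for
indices in any order. *)
Definition minor_var (i : 'I_n) (a b : 'I_h.+1) : pol :=
  if insub (a, b) : option (plucker_index h) is Some ab then 'X_(enum_rank (i, ab))
  else if insub (b, a) : option (plucker_index h) is Some ba
       then (-1)%:MP * 'X_(enum_rank (i, ba)) else 0.

Lemma multidegree_minor_var i a b :
  multidegree (fun j => (j == i) : nat) (minor_var i a b).
Proof.
rewrite /minor_var; case: insubP => [ab _ _|_]; first exact: multidegreeX.
case: insubP => [ba _ _|_]; last exact: multidegree0.
exact/multidegreeZ/multidegreeX.
Qed.

Lemma eval_minor_var M i a b :
  (minor_var i a b).@[flat (minors M)] = minor (C i *m M) a b.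
Proof.
rewrite /minor_var; case: insubP => [ab _ eab|/=].
  by rewrite mevalXU /flat enum_rankK /minors eab.
rewrite -leqNgt => ba; case: insubP => [ba' _ eba|/=].
  by rewrite mevalM mevalC mevalXU /flat enum_rankK /minors eba /minor /=; ring.
rewrite -leqNgt => ab; have -> : a = b by apply/val_inj/eqP; rewrite eqn_leq ab ba.
by rewrite meval0 /minor subrr.
Qed.

(** If [l] and [m] factor through the camera, Cauchy-Binet writes their wedge as
a combination of the minors of the picture. *)
Lemma wedge_form i (l m : 'rV[K]_4) : (l <= C i)%MS -> (m <= C i)%MS ->
  exists D (f : pol), multidegree D f /\
    forall M, f.@[flat (minors M)] = wedge l m M.
Proof.
move=> /submxP[l' ->] /submxP[m' ->].
exists (fun j => (j == i) : nat).
exists (\sum_a \sum_b (l' 0 a * m' 0 b)%:MP * minor_var i a b); split.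
  by do 2!apply: multidegree_sum => ? _; exact/multidegreeZ/multidegree_minor_var.
move=> M; rewrite /wedge -!mulmxA; set N := C i *m M.
rewrite !mxE !big_distrlr /= -sumrB rmorph_sum; apply: eq_bigr => a _.
rewrite -sumrB rmorph_sum; apply: eq_bigr => b _.
by rewrite /= mevalM mevalC eval_minor_var -/N /minor; ring.
Qed.

Theorem chain_exists (d : nat) (X : set points) (F : nat -> set 'M[K]_(4, 2)) M
    (l m : nat -> 'rV[K]_4) :
  camera_points (F d) `<=` X ->
  (forall k, affine_closed (F k)) -> (forall k, F k `<=` F k.+1) ->
  F 0%N M -> defined_at M ->
  (forall k, (k < d)%N -> exists i, (l k <= C i)%MS && (m k <= C i)%MS) ->
  (forall k N, (k < d)%N -> F k N -> wedge (l k) (m k) N = 0) ->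
  (forall k, (k < d)%N -> exists2 N, F k.+1 N & wedge (l k) (m k) N != 0) ->
  exists Z, irreducible_chain (zariski_closure X) d Z.
Proof.
move=> FX aF subF F0M dM hlm w0 wn.
have FM k : F k M by elim: k => // k; exact: subF.
have FFd k : (k <= d)%N -> F k `<=` F d.
  move=> kd; rewrite -(subnKC kd); elim: (d - k)%N => [|j IH]; first by rewrite addn0.
  by rewrite addnS; apply: subset_trans IH _; exact: subF.
exists (fun k => zariski_closure (camera_points (F k))); split=> k kd.
  split; [exact: closed_closure| exact: irreducible_closure_camera_points (FM k) dM|].
  apply: closure_sub; first exact: closed_closure.
  move=> p [N FN hN]; apply: sub_closure; apply: FX; exists N => //; exact: FFd FN.
have [i /andP[lC mC]] := hlm k kd.
have [D [f [hf fE]]] := wedge_form lC mC.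
split.
  apply: closure_sub; first exact: closed_closure.
  by move=> p [N FN hN]; apply: sub_closure; exists N => //; exact: subF.
have [N FN wN] := wn k kd; move=> sub.
have m1 : (1 : pol).@[flat (minors M)] != 0 by rewrite meval1 oner_eq0.
have fN : f.@[flat (minors N)] != 0 by rewrite fE.
have h1 : multidegree (fun=> 0%N) (1 : pol) := multidegreeC (c := 1).
have [p [Fp _ /eqP fp]] :=
  generic_camera_point (aF k.+1) (FM k.+1) FN dM h1 hf m1 fN.
apply: fp; apply: (vanishes_closure hf _ (sub _ (sub_closure Fp))).
move=> q [N' FN' hq]; apply/eqP; rewrite (camera_points_eval hf hq) fE.
by rewrite (w0 k N' kd FN').
Qed.

End LowerBound.

(** * Avoiding subspaces *)

Section Avoidance.
Variable K : numFieldType.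

(** Among the natural numbers, each condition excludes at most one. *)
Lemma exists_avoiding (I : eqType) (r : seq I) (P : I -> pred K) :
  (forall i s s', i \in r -> P i s -> P i s' -> s = s') ->
  exists s, forall i, i \in r -> ~~ P i s.
Proof.
move=> inj.
suff [N hN] : exists N, forall k, (N <= k)%N -> forall i, i \in r -> ~~ P i k%:R.
  by exists N%:R; exact: hN.
elim: r inj => [|i r IH] inj; first by exists 0%N.
have [j s s' jr|N hN] := IH; first by apply: inj; rewrite inE jr orbT.
have [[k Pk]|none] := pselect (exists k : nat, P i k%:R).
  exists (maxn N k.+1) => l; rewrite geq_max => /andP[Nl kl] j.
  rewrite inE => /orP[/eqP ->|]; last exact: hN.
  apply/negP => Pl; have /eqP := inj i _ _ (mem_head _ _) Pk Pl.
  by rewrite eqr_nat => /eqP e; move: kl; rewrite e ltnn.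
exists N => l Nl j; rewrite inE => /orP[/eqP ->|]; last exact: hN.
by apply/negP => Pl; apply: none; exists l.
Qed.

Lemma exists_notin (V : vectType K) (U : {vspace V}) :
  (\dim U < dim V)%N -> exists v, v \notin U.
Proof.
move=> dU; apply: contrapT => none.
suff : (fullv <= U)%VS by move/dimvS; rewrite dimvf leqNgt dU.
by apply/subvP => v _; apply: contrapT => /negP nv; apply: none; exists v.
Qed.

(** Induction on the number of subspaces.  If [v] avoids all but [U], move it
along a direction [w] outside [U]: each subspace contains at most one point of
this line, for otherwise it would contain [w], and then [v]. *)
Lemma avoid_subspaces (V : vectType K) (Us : seq {vspace V}) :
  (forall U, U \in Us -> (\dim U < dim V)%N) ->
  exists v, forall U, U \in Us -> v \notin U.
Proof.
elim: Us => [|U Us IH] hU; first by exists 0.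
have [U' hU'|v hv] := IH; first by apply: hU; rewrite inE hU' orbT.
have [w wU] := exists_notin (hU U (mem_head _ _)).
have [vU|vU] := boolP (v \in U); last first.
  by exists v => U'; rewrite inE => /orP[/eqP ->|/hv].
pose P (U' : {vspace V}) (s : K) := v + s *: w \in U'.
have [U' s s' hU' Ps Ps'|s hs] := @exists_avoiding _ (U :: Us) P; last first.
  by exists (v + s *: w).
apply/eqP; rewrite -subr_eq0; apply/negPn/negP => ss.
have wU' : w \in U'.
  have : (s - s') *: w \in U'.
    have -> : (s - s') *: w = (v + s *: w) - (v + s' *: w).
      by rewrite opprD addrACA subrr add0r scalerBl.
    exact: rpredB.
  by rewrite rpredZeq (negbTE ss).
move: hU'; rewrite inE => /orP[/eqP e|/hv].
  by move: wU; rewrite -e wU'.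
by case/negP; move: Ps; rewrite /P rpredDr // rpredZ.
Qed.

End Avoidance.

(** * Bases of a four-dimensional space *)

Section Space4.
Variable K : fieldType.
Local Notation vec := 'cV[K]_4.
Implicit Types (x y u v w : vec).

Lemma sum_ord4 (V : nmodType) (F : 'I_4 -> V) :
  \sum_i F i = F 0 + (F 1 + (F 2 + F 3)).
Proof.
rewrite !big_ord_recl big_ord0 addr0.
by do ?[congr (_ + _)]; congr (F _); apply: val_inj.
Qed.

Lemma ord4P (P : 'I_4 -> Prop) : P 0 -> P 1 -> P 2 -> P 3 -> forall i, P i.
Proof.
move=> P0 P1 P2 P3 [[|[|[|[|//]]]] hi].
- by rewrite (_ : Ordinal hi = 0) //; apply: val_inj.
- by rewrite (_ : Ordinal hi = 1) //; apply: val_inj.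
- by rewrite (_ : Ordinal hi = 2) //; apply: val_inj.
- by rewrite (_ : Ordinal hi = 3) //; apply: val_inj.
Qed.

Lemma ord2P (P : 'I_2 -> Prop) : P 0 -> P 1 -> forall i, P i.
Proof.
move=> P0 P1 [[|[|//]] hi].
- by rewrite (_ : Ordinal hi = 0) //; apply: val_inj.
- by rewrite (_ : Ordinal hi = 1) //; apply: val_inj.
Qed.

Definition vec4 (a b c d : K) : vec := \col_i [:: a; b; c; d]`_i.
Definition covec4 (a b c d : K) : 'rV[K]_4 := \row_i [:: a; b; c; d]`_i.

Lemma vec4K x : x = vec4 (x 0 0) (x 1 0) (x 2 0) (x 3 0).
Proof. by apply/colP; apply: ord4P; rewrite mxE. Qed.

Definition cols4 (x0 x1 x2 x3 : vec) : 'M[K]_4 :=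
  \matrix_(i, j) [:: x0; x1; x2; x3]`_j i 0.

Lemma mul_cols4 x0 x1 x2 x3 w : cols4 x0 x1 x2 x3 *m w =
  w 0 0 *: x0 + (w 1 0 *: x1 + (w 2 0 *: x2 + w 3 0 *: x3)).
Proof.
by apply/colP => i; rewrite !mxE sum_ord4 !mxE /=; do !congr (_ + _); rewrite mulrC.
Qed.

Lemma mul_cols4_vec4 x0 x1 x2 x3 a b c d : cols4 x0 x1 x2 x3 *m vec4 a b c d =
  a *: x0 + (b *: x1 + (c *: x2 + d *: x3)).
Proof. by rewrite mul_cols4 !mxE. Qed.

Lemma unitmx_inj m (A : 'M[K]_m) : (forall w : 'cV_m, A *m w = 0 -> w = 0) ->
  A \in unitmx.
Proof.
move=> inj; rewrite -unitmx_tr -row_free_unit -kermx_eq0; apply/rowV0P => w.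
move/sub_kermxP/(congr1 trmx); rewrite trmx_mul trmxK trmx0 => /inj w0.
by rewrite -[w]trmxK w0 trmx0.
Qed.

Lemma cols4_unit x0 x1 x2 x3 : free [:: x0; x1; x2; x3] ->
  cols4 x0 x1 x2 x3 \in unitmx.
Proof.
move=> fr; apply: unitmx_inj => w; rewrite mul_cols4 => w0.
have f := freeP (X := [tuple x0; x1; x2; x3]) fr (fun i => w i 0).
apply/colP => i; rewrite mxE; apply: f.
by rewrite sum_ord4 -[RHS]w0.
Qed.

Definition cols2 m (u v : 'cV[K]_m) : 'M[K]_(m, 2) :=
  \matrix_(i, j) (if j == 0 then u else v) i 0.

Lemma cols2E m (u v : 'cV[K]_m) (w : 'cV[K]_2) :
  cols2 u v *m w = w 0 0 *: u + w 1 0 *: v.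
Proof. by apply/colP => i; rewrite !mxE sum_ord2 !mxE /= mulrC [_ * v _ _]mulrC. Qed.

Lemma mul_cols2 p m (A : 'M[K]_(p, m)) (u v : 'cV[K]_m) :
  A *m cols2 u v = cols2 (A *m u) (A *m v).
Proof.
by apply/matrixP => i; apply: ord2P; rewrite !mxE; apply: eq_bigr => k _; rewrite mxE.
Qed.

Lemma memv_span2 (V : vectType K) (a b x : V) :
  reflect (exists k l, x = k *: a + l *: b) (x \in <<[:: a; b]>>%VS).
Proof.
rewrite span_cons span_seq1; apply: (iffP memv_addP).
  by case=> _ /vlineP[k ->] [_ /vlineP[l ->] ->]; exists k, l.
by case=> k [l ->]; exists (k *: a); rewrite ?memvZ ?memv_line ?orbT //;
   exists (l *: b); rewrite ?memvZ ?memv_line ?orbT.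
Qed.

Lemma colspan_cols2 m (u v : 'cV[K]_m) : colspan (cols2 u v) = <<[:: u; v]>>%VS.
Proof.
apply/vspaceP => x; apply/memv_colspanP/memv_span2 => -[].
  by move=> w ->; exists (w 0 0), (w 1 0); rewrite cols2E.
move=> k [l ->]; exists (\col_i (if i == 0 then k else l)).
by rewrite cols2E !mxE.
Qed.

Lemma dim_span2 (V : vectType K) (u v : V) : free [:: u; v] -> \dim <<[:: u; v]>> = 2%N.
Proof. by move/eqP. Qed.

Lemma span2_eq (V : vectType K) (U : {vspace V}) (a b : V) : \dim U = 2%N ->
  free [:: a; b] -> a \in U -> b \in U -> U = <<[:: a; b]>>%VS.
Proof.
move=> d2 fr aU bU; apply/esym/eqP; rewrite eqEdim d2 dim_span2 // leqnn andbT.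
by apply/span_subvP => x; rewrite !inE => /orP[] /eqP ->.
Qed.

Lemma colspan_cols2_eq m (E : {vspace 'cV[K]_m}) (u v : 'cV[K]_m) :
  \dim E = 2%N -> free [:: u; v] -> u \in E -> v \in E -> E = colspan (cols2 u v).
Proof. by rewrite colspan_cols2; exact: span2_eq. Qed.

Lemma line_basis m (E : {vspace 'cV[K]_m}) : \dim E = 2%N ->
  exists u v : 'cV[K]_m, free [:: u; v] /\ E = <<[:: u; v]>>%VS.
Proof.
move=> d2; exists (vbasis E)`_0, (vbasis E)`_1.
have -> : [:: (vbasis E)`_0; (vbasis E)`_1] = vbasis E.
  by case: (vbasis E) => [[|x [|y [|]]]]; rewrite /= d2.
by rewrite (basis_free (vbasisP E)) (span_basis (vbasisP E)).
Qed.

Lemma free2P (V : vectType K) (u v : V) : reflect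
  (u != 0 /\ v \notin <[u]>%VS) (free [:: u; v]).
Proof.
rewrite (perm_free (Y := [:: v; u])) ?(perm_catC [:: u] [:: v]) //.
by rewrite free_cons span_seq1 seq1_free andbC; apply: (iffP andP).
Qed.

Lemma exists_coord_neq0 m (u : 'cV[K]_m) : u != 0 -> exists a, u a 0 != 0.
Proof.
move=> u0; apply: contrapT => none; case/negP: u0; apply/eqP/colP => a.
by rewrite mxE; apply/eqP/negP => /negP ua; apply: none; exists a.
Qed.

(** One linear equation on a two-dimensional space. *)
Lemma line_vanishing_coord m (E : {vspace 'cV[K]_m}) a : \dim E = 2%N ->
  exists v : 'cV[K]_m, [/\ v \in E, v != 0 & v a 0 = 0].
Proof.
move=> /line_basis[x [y [/free2P[x0 yx] ->]]].
have [xE yE] : x \in <<[:: x; y]>>%VS /\ y \in <<[:: x; y]>>%VS.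
  by rewrite !memv_span // !inE eqxx ?orbT.
have [xa|xa] := eqVneq (x a 0) 0; first by exists x.
exists (y - (y a 0 / x a 0) *: x); split.
- by rewrite rpredB // rpredZ.
- rewrite subr_eq0; apply: contra yx => /eqP ->; exact/memvZ/memv_line.
by rewrite !mxE divfK // subrr.
Qed.

(** A nonzero vector with vanishing [a]-th coordinate is independent of a vector
whose [a]-th coordinate does not vanish. *)
Lemma colspan_pivot m (E : {vspace 'cV[K]_m}) (u v : 'cV[K]_m) a (k l : K) :
  \dim E = 2%N ->
  u \in E -> v \in E -> u a 0 != 0 -> v != 0 -> v a 0 = 0 -> k != 0 -> l != 0 ->
  E = colspan (cols2 (k *: u) (l *: v)).
Proof.
move=> d2 uE vE ua v0 va k0 l0; apply: colspan_cols2_eq; rewrite ?memvZ ?uE ?vE ?orbT //.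
apply/free2P; split.
  by rewrite scaler_eq0 negb_or k0; apply: contraNneq ua => ->; rewrite mxE.
apply/vlineP => -[s /colP e].
have := e a; rewrite !mxE va mulr0 => /esym/eqP.
rewrite !mulf_eq0 (negbTE k0) (negbTE ua) !orbF => /eqP s0.
case/negP: v0; apply/eqP/colP => b; apply/eqP; have := e b.
by rewrite s0 scale0r !mxE => /eqP; rewrite mulf_eq0 (negbTE l0).
Qed.

(** After scaling to 1 a nonzero coordinate, the other coordinates of the support
are the parameters. *)
Lemma scale_to_chart (u : vec) (r : seq 'I_4) : u != 0 -> uniq r ->
  (forall a, a \notin r -> u a 0 = 0) ->
  exists k (ts : seq K) a, [/\ k != 0, size ts = (size r).-1, u a 0 != 0 &
    forall b, (k *: u) b 0 \in [:: 0, 1 & ts]].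
Proof.
move=> /exists_coord_neq0[a ua] ur hr.
have ar : a \in r by apply: contraNT ua => /hr ->.
exists (u a 0)^-1, [seq (u a 0)^-1 * u b 0 | b <- rem a r], a.
split=> [|| //|b]; first by rewrite invr_eq0.
  by rewrite size_map size_rem.
rewrite mxE !inE; have [->|ba] := eqVneq b a; first by rewrite mulVf // eqxx orbT.
have [br|/hr ->] := boolP (b \in r); last by rewrite mulr0 eqxx.
apply/orP; right; apply/orP; right.
by apply/mapP; exists b => //; rewrite rem_filter // mem_filter /= ba.
Qed.

Lemma free4_direct (x0 x1 x2 x3 : vec) : free [:: x0; x1] -> free [:: x2; x3] ->
  (<<[:: x0; x1]>> :&: <<[:: x2; x3]>> = 0)%VS -> free [:: x0; x1; x2; x3].
Proof.
move=> f1 f2 d; rewrite -[X in free X]/([:: x0; x1] ++ [:: x2; x3]) cat_free f1 f2.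
exact/directv_addP.
Qed.

Lemma free2_inj (V : vectType K) (a b : V) :
  (forall k l, k *: a + l *: b = 0 -> k = 0 /\ l = 0) -> free [:: a; b].
Proof.
move=> inj; apply/free2P; split.
  apply/eqP => a0; have [] := inj 1 0; first by rewrite a0 scaler0 scale0r addr0.
  by move/eqP; rewrite oner_eq0.
apply/vlineP => -[k e]; have [] := inj k (-1).
  by rewrite e scaleN1r subrr.
by move=> _ /eqP; rewrite oppr_eq0 oner_eq0.
Qed.

Lemma free2_inj_conv (V : vectType K) (a b : V) k l :
  free [:: a; b] -> k *: a + l *: b = 0 -> k = 0 /\ l = 0.
Proof.
move=> /free2P[a0 ba] e; have [l0|l0] := eqVneq l 0.
  move/eqP: e; rewrite l0 scale0r addr0 scaler_eq0 (negbTE a0) orbF.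
  by move/eqP.
case/negP: ba; apply/vlineP; exists (- (l^-1 * k)).
apply: (scalerI l0); rewrite scalerA mulrN mulrA divff // mul1r scaleNr.
by apply/eqP; rewrite -addr_eq0 addrC e.
Qed.

(** Any three skew lines are equivalent: the third is the graph of an
isomorphism from the first to the second, and a basis of the first is
transported by it. *)
Lemma regulus_basis (L1 L2 L3 : {vspace vec}) :
  \dim L1 = 2%N -> \dim L2 = 2%N -> \dim L3 = 2%N ->
  (L1 :&: L2 = 0)%VS -> (L1 :&: L3 = 0)%VS -> (L2 :&: L3 = 0)%VS ->
  exists x0 x1 x2 x3, [/\ L1 = <<[:: x0; x1]>>%VS, L2 = <<[:: x2; x3]>>%VS,
    L3 = <<[:: (x0 + x2)%R; (x1 + x3)%R]>>%VS & free [:: x0; x1; x2; x3]].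
Proof.
move=> d1 d2 d3 i12 i13 i23.
have full : (L1 + L2 = fullv)%VS.
  apply/eqP; rewrite eqEdim subvf dimvf dim_matrix.
  by have := dimv_sum_cap L1 L2; rewrite i12 dimv0 d1 d2 addn0 => ->.
have [p [q [fpq e3]]] := line_basis d3.
have [pL qL] : p \in L3 /\ q \in L3 by rewrite e3 !memv_span // !inE eqxx ?orbT.
have /memv_addP[p1 p1L [p2 p2L ep]] : p \in (L1 + L2)%VS by rewrite full memvf.
have /memv_addP[q1 q1L [q2 q2L eq]] : q \in (L1 + L2)%VS by rewrite full memvf.
have cap0 (U : {vspace vec}) k l :
    (U :&: L3 = 0)%VS -> k *: p + l *: q \in U -> k = 0 /\ l = 0.
  move=> i xU; apply: free2_inj_conv fpq _; apply/eqP.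
  by rewrite -memv0 -i memv_cap xU rpredD ?rpredZ.
have f1 : free [:: p1; q1].
  apply: free2_inj => k l e; apply: (cap0 L2) => //.
  by rewrite ep eq !scalerDr addrACA e add0r rpredD ?rpredZ.
have f2 : free [:: p2; q2].
  apply: free2_inj => k l e; apply: (cap0 L1) => //.
  by rewrite ep eq !scalerDr addrACA e addr0 rpredD ?rpredZ.
have e1 := span2_eq d1 f1 p1L q1L; have e2 := span2_eq d2 f2 p2L q2L.
exists p1, q1, p2, q2; split=> //; first by rewrite e3 ep eq.
by apply: free4_direct; rewrite -?e1 -?e2.
Qed.

End Space4.

(** * Chains of maximal length *)

Section Families.
Variables (K : numFieldType) (h n : nat) (C : 'I_n -> 'M[K]_(h.+1, 4)).
Local Notation points := (gr_prod K h n).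
Local Notation vec := 'cV[K]_4.

Definition incident (U V : {vspace vec}) := exists x, [/\ x != 0, x \in U & x \in V].

(** When [y] spans the center of some camera [i], every linear form vanishing at
[y] factors through [C i]. *)
Definition sees_through (y : vec) :=
  exists i, forall l : 'rV[K]_4, l *m y = 0 -> (l <= C i)%MS.

(** Every nonzero vector killed by some camera has a multiple in [cs]: a line
avoiding [cs] has a picture in every camera. *)
Definition centers_among (cs : seq vec) :=
  forall i x, C i *m x = 0 -> x != 0 -> exists2 c, c \in cs & exists a, c = a *: x.

Definition affine_map (Phi : (nat -> K) -> 'M[K]_(4, 2)) :=
  forall t t' s, Phi (fun j => t j + s * (t' j - t j)) =
                 Phi t + s *: (Phi t' - Phi t).

(** The specialization of [chain_exists] to a family given in the coordinates of
a basis [P], where the members with [t j = 0] for [k <= j] form the [k]-th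
set.  Each wedge is taken of two forms vanishing at the same point [y], so that
a single camera sees both. *)
Lemma family_chain d (X : set points) (P : 'M[K]_4) Phi (l m : nat -> 'rV[K]_4) :
  P \in unitmx -> affine_map Phi ->
  (forall p t, (forall i, line_vs (p i) = colspan (C i *m (P *m Phi t))) -> X p) ->
  (forall i (w : 'cV_2), C i *m (P *m Phi (fun=> 0)) *m w = 0 -> w = 0) ->
  (forall k, (k < d)%N -> exists y,
     [/\ sees_through (P *m y), l k *m y = 0 & m k *m y = 0]) ->
  (forall k t, (k < d)%N -> (forall j, (k <= j)%N -> t j = 0) ->
     wedge (l k) (m k) (Phi t) = 0) ->
  (forall k, (k < d)%N -> exists2 t, (forall j, (k < j)%N -> t j = 0) &
     wedge (l k) (m k) (Phi t) != 0) ->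
  exists Z, irreducible_chain (zariski_closure X) d Z.
Proof.
move=> uP aPhi hX dPhi hlm w0 wn.
pose F k : set 'M[K]_(4, 2) :=
  [set M | exists2 t, (forall j, (k <= j)%N -> t j = 0) & M = Phi t].
apply: (@chain_exists _ _ _ (fun i => C i *m P) d X F (Phi (fun=> 0)) l m).
- by move=> p [_ [t _ ->] hp]; apply: (hX p t) => i; rewrite hp mulmxA.
- move=> k _ _ s [t ht ->] [t' ht' ->]; rewrite -aPhi.
  by eexists; last reflexivity; move=> j kj /=; rewrite ht // ht' // subrr mulr0 addr0.
- by move=> k _ [t ht ->]; exists t => // j /ltnW; exact: ht.
- by exists (fun=> 0).
- by move=> i w; rewrite -(mulmxA (C i)); exact: dPhi.
- move=> k kd; have [y [[i hi] ly my]] := hlm k kd.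
  have sub (r : 'rV[K]_4) : r *m y = 0 -> (r <= C i *m P)%MS.
    move=> ry; rewrite -[r](mulmxKV uP); apply: submxMr; apply: hi.
    by rewrite mulmxA mulmxKV.
  by exists i; rewrite !sub.
- by move=> k _ kd [t ht ->]; exact: w0.
move=> k kd; have [t ht wt] := wn k kd.
by exists (Phi t) => //; exists t.
Qed.

Lemma wedge_cols2 a0 a1 a2 a3 b0 b1 b2 b3 u0 u1 u2 u3 v0 v1 v2 v3 :
  wedge (covec4 a0 a1 a2 a3) (covec4 b0 b1 b2 b3)
    (cols2 (vec4 u0 u1 u2 u3) (vec4 v0 v1 v2 v3)) =
  (a0 * u0 + a1 * u1 + a2 * u2 + a3 * u3) * (b0 * v0 + b1 * v1 + b2 * v2 + b3 * v3) -
  (a0 * v0 + a1 * v1 + a2 * v2 + a3 * v3) * (b0 * u0 + b1 * u1 + b2 * u2 + b3 * u3)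
  :> K.
Proof. by rewrite /wedge !mxE !sum_ord4 !mxE /=; ring. Qed.

Lemma covec4_vec4 a0 a1 a2 a3 u0 u1 u2 u3 :
  a0 * u0 + a1 * u1 + a2 * u2 + a3 * u3 = 0 :> K ->
  covec4 a0 a1 a2 a3 *m vec4 u0 u1 u2 u3 = 0.
Proof.
move=> e; apply/rowP => i; rewrite ord1 !mxE sum_ord4 !mxE /= -[RHS]e; ring.
Qed.

Lemma camera_image_colspan (Lambda : set (Gr1 K 3)) (p : points) M : (0 < n)%N ->
  (forall i, line_vs (p i) = colspan (C i *m M)) ->
  (forall E : Gr1 K 3, line_vs E = colspan M -> Lambda E) ->
  camera_image C Lambda p.
Proof.
move=> n0 hp hL.
have inj (w : 'cV_2) : M *m w = 0 -> w = 0.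
  have /dim_colspan inj : \dim (colspan (C (Ordinal n0) *m M)) = 2%N.
    by rewrite -hp; exact/eqP/dim_line_vs.
  by move=> Mw; apply: inj; rewrite -mulmxA Mw mulmx0.
have [E hE] := line_of_colspan inj.
exists E; first exact: hL.
by move=> i; rewrite hE camera_map_colspan.
Qed.

Lemma line_cols2_neq0 (E : Gr1 K 3) (u v : vec) : line_vs E = colspan (cols2 u v) ->
  [/\ u != 0, v != 0 & u + v != 0].
Proof.
rewrite colspan_cols2 => hE; have := dim_line_vs E; rewrite hE -/(free _) => fr.
have /free2P[u0 vu] := fr; split=> //.
  by apply: (free_not0 fr); rewrite !inE eqxx orbT.
by rewrite addrC addr_eq0; apply: contra vu => /eqP ->; rewrite rpredN memv_line.
Qed.

Lemma mem_cols2 (u v : vec) a b : a *: u + b *: v \in colspan (cols2 u v).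
Proof. by rewrite colspan_cols2; apply/memv_span2; exists a, b. Qed.

Lemma mem_cols2l (u v : vec) : u \in colspan (cols2 u v).
Proof. by have := mem_cols2 u v 1 0; rewrite scale1r scale0r addr0. Qed.

Lemma mem_cols2r (u v : vec) : v \in colspan (cols2 u v).
Proof. by have := mem_cols2 u v 0 1; rewrite scale1r scale0r add0r. Qed.

Lemma defined_at_centers cs u v : centers_among cs -> free [:: u; v] ->
  (forall c, c \in cs -> c != 0) ->
  (forall c, c \in cs -> c \notin <<[:: u; v]>>%VS) ->
  forall i (w : 'cV_2), C i *m cols2 u v *m w = 0 -> w = 0.
Proof.
move=> hcs fr cs0 hc i w; rewrite -mulmxA => Cw.
have inj : forall w : 'cV_2, cols2 u v *m w = 0 -> w = 0.
  by apply/dim_colspan; rewrite colspan_cols2 dim_span2.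
apply: inj; apply: contrapT => /eqP Mw.
have [c ccs [a ca]] := hcs i _ Cw Mw.
case/negP: (hc c ccs); rewrite ca rpredZ // -colspan_cols2.
by apply/memv_colspanP; exists w.
Qed.

(** The second point of the line has to avoid the span of [u], [y1], [y2] and
the lines joining [u] to the points of [cs]. *)
Lemma generic_line (cs : seq vec) (u y1 y2 : vec) : free [:: y1; y2] ->
  u \notin <<[:: y1; y2]>>%VS -> (forall c, c \in cs -> c \notin <[u]>%VS) ->
  exists v, free [:: u; v; y1; y2] /\
    forall c, c \in cs -> c \notin <<[:: u; v]>>%VS.
Proof.
move=> fr uy hc.
pose Us := <<[:: u; y1; y2]>>%VS :: [seq <<[:: u; c]>>%VS | c <- cs].
have [U|v hv] := @avoid_subspaces K vec Us.
  rewrite inE dim_matrix => /orP[/eqP ->|/mapP[c _ ->]].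
    exact: leq_ltn_trans (dim_span _) _.
  exact: leq_ltn_trans (dim_span _) _.
exists v; split.
  rewrite (perm_free (Y := [:: v; u; y1; y2])) ?(perm_catCA [:: u] [:: v]) //.
  by rewrite free_cons hv ?mem_head // free_cons uy fr.
move=> c ccs; apply/memv_span2 => -[k [l e]].
have [l0|l0] := eqVneq l 0.
  by case/negP: (hc c ccs); rewrite e l0 scale0r addr0 memvZ // memv_line.
have /negP[] : v \notin <<[:: u; c]>>%VS.
  by apply: hv; rewrite inE; apply/orP; right; apply/mapP; exists c.
apply/memv_span2; exists (- (l^-1 * k)), l^-1; rewrite e scalerDr !scalerA mulVf //.
by rewrite scale1r addrA -scalerDl addNr scale0r add0r.
Qed.

Ltac affine_tac := move=> ? ? ?; apply/matrixP; apply: ord4P; apply: ord2P;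
  rewrite !mxE /= ?subrr ?mulr0 ?addr0 //; ring.

(** In a basis consisting of two points of the line at the origin and of [y1],
[y2], move the line by [t 2 *: y1 + t 3 *: y2] at its first point and by
[t 0 *: y1 + t 1 *: y2] at its second one.  Up to sign each parameter is the
wedge of two coordinate forms, both vanishing at [y1] or both at [y2]. *)
Lemma lines_chain (Lambda : set (Gr1 K 3)) cs (y1 y2 : vec) : (0 < n)%N ->
  (forall E, Lambda E) -> centers_among cs -> (forall c, c \in cs -> c != 0) ->
  sees_through y1 -> sees_through y2 -> free [:: y1; y2] ->
  exists Z, irreducible_chain (zariski_closure (camera_image C Lambda)) 4 Z.
Proof.
move=> n0 hL hcs cs0 hy1 hy2 fr.
have [U|u hu] := @avoid_subspaces K vec
    (<<[:: y1; y2]>>%VS :: [seq <[c]>%VS | c <- cs]).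
  rewrite inE dim_matrix => /orP[/eqP ->|/mapP[c _ ->]].
    exact: leq_ltn_trans (dim_span _) _.
  by rewrite dim_vline; case: (c != 0).
have uy : u \notin <<[:: y1; y2]>>%VS by apply: hu; rewrite mem_head.
have hcu c : c \in cs -> c \notin <[u]>%VS.
  move=> ccs; have : u \notin <[c]>%VS.
    by apply: hu; rewrite inE; apply/orP; right; apply/mapP; exists c.
  apply: contra => /vlineP[k e]; apply/vlineP; exists k^-1.
  rewrite e scalerA mulVf ?scale1r //.
  by apply: contraNneq (cs0 c ccs) => k0; rewrite e k0 scale0r.
have [v [frP hcv]] := generic_line fr uy hcu.
have uP := cols4_unit frP; set P := cols4 u v y1 y2 in uP.
pose Phi t := cols2 (vec4 1 0 (t 2%N) (t 3%N)) (vec4 0 1 (t 0%N) (t 1%N)) : 'M[K]_(4, 2).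
have Pe2 : P *m vec4 0 0 1 0 = y1.
  by rewrite mul_cols4_vec4 !scale0r scale1r !add0r addr0.
have Pe3 : P *m vec4 0 0 0 1 = y2.
  by rewrite mul_cols4_vec4 !scale0r scale1r !add0r.
pose l k := nth 0 [:: covec4 1 0 0 0; covec4 1 0 0 0;
                     covec4 0 1 0 0; covec4 0 1 0 0] k : 'rV[K]_4.
pose m k := nth 0 [:: covec4 0 0 1 0; covec4 0 0 0 1;
                     covec4 0 0 1 0; covec4 0 0 0 1] k : 'rV[K]_4.
apply: (@family_chain 4 _ P Phi l m) => //.
- affine_tac.
- by move=> p t hp; apply: camera_image_colspan hp _.
- have -> : P *m Phi (fun=> 0) = cols2 u v.
    by rewrite mul_cols2 !mul_cols4_vec4 !scale0r !scale1r !addr0 add0r.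
  apply: defined_at_centers hcs _ cs0 hcv.
  by move: frP; rewrite -[[:: u; v; y1; y2]]/([:: u; v] ++ [:: y1; y2]) cat_free => /and3P[].
- case=> [|[|[|[|//]]]] _; [exists (vec4 0 0 0 1) | exists (vec4 0 0 1 0)
    | exists (vec4 0 0 0 1) | exists (vec4 0 0 1 0)]; rewrite ?Pe2 ?Pe3;
  by split=> //; apply: covec4_vec4; ring.
- by case=> [|[|[|[|//]]]] t _ ht; have := ht _ (leqnn _); rewrite wedge_cols2 => ->; ring.
move=> k k4; exists (fun j => (j == k)%:R) => [j kj|]; first by rewrite gtn_eqF.
case: k k4 => [|[|[|[|//]]]] _; rewrite wedge_cols2 /=.
- by rewrite (_ : _ - _ = 1) ?oner_eq0 //; ring.
- by rewrite (_ : _ - _ = 1) ?oner_eq0 //; ring.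
- by rewrite (_ : _ - _ = -1) ?oppr_eq0 ?oner_eq0 //; ring.
- by rewrite (_ : _ - _ = -1) ?oppr_eq0 ?oner_eq0 //; ring.
Qed.

(** Here the first point [u] of the line is only moved along [L], in a direction
[w] without component along [u].  The two parameters of the second point are
wedges as in [lines_chain]; the third form vanishes at [t 2 = 0], and it is
not identically zero because [w], which lies on [L], is not a multiple of
[y1]. *)
Lemma transversals_chain (Lambda : set (Gr1 K 3)) (L : {vspace vec}) cs (y1 y2 : vec) :
  (0 < n)%N -> \dim L = 2%N -> (forall E : Gr1 K 3, incident E L -> Lambda E) ->
  centers_among cs -> (forall c, c \in cs -> c \notin L) ->
  y1 \notin L -> y2 \notin L ->
  sees_through y1 -> sees_through y2 -> free [:: y1; y2] ->
  exists Z, irreducible_chain (zariski_closure (camera_image C Lambda)) 3 Z.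
Proof.
move=> n0 dL hL hcs csL y1L y2L hy1 hy2 fr.
have cs0 c : c \in cs -> c != 0.
  by move=> /csL; apply: contraNneq => ->; rewrite mem0v.
have [u uL uy] : exists2 u, u \in L & u \notin <<[:: y1; y2]>>%VS.
  apply: contrapT => none; case/negP: y1L.
  suff -> : L = <<[:: y1; y2]>>%VS by rewrite memv_span ?mem_head.
  apply/eqP; rewrite eqEdim dL dim_span2 // leqnn andbT.
  by apply/subvP => x xL; apply: contrapT => /negP nx; apply: none; exists x.
have hcu c : c \in cs -> c \notin <[u]>%VS.
  by move=> /csL; apply: contra => /vlineP[k ->]; rewrite rpredZ.
have [v [frP hcv]] := generic_line fr uy hcu.
have uP := cols4_unit frP; set P := cols4 u v y1 y2 in uP.
(* A direction [w] of [L], first found as [w'] and then cleared of its component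
   along [u]. *)
have [w' w'L w'u] : exists2 w, w \in L & w \notin <[u]>%VS.
  apply: contrapT => none; suff /dimvS : (L <= <[u]>)%VS.
    by rewrite dL dim_vline; case: (u != 0).
  by apply/subvP => x xL; apply: contrapT => /negP nx; apply: none; exists x.
have := mulKVmx uP w'; rewrite (vec4K (invmx P *m w')).
move: (_ 0 0) (_ 1 0) (_ 2 0) (_ 3 0) => a b c d.
rewrite mul_cols4_vec4 => ew'.
pose w := b *: v + (c *: y1 + d *: y2).
have w_def : w = w' - a *: u by rewrite -ew' addrC addKr.
have wL : w \in L by rewrite w_def rpredB // rpredZ.
have w0 : w != 0.
  rewrite w_def subr_eq0; apply: contra w'u => /eqP ->; exact/memvZ/memv_line.
(* Otherwise [w] would be a multiple of [y1]. *)
have bd : (b != 0) || (d != 0).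
  rewrite -negb_and; apply/negP => /andP[/eqP b0 /eqP d0].
  move: wL w0; rewrite /w b0 d0 !scale0r add0r addr0 rpredZeq (negbTE y1L) orbF.
  by move=> /eqP ->; rewrite scale0r eqxx.
pose Phi t := cols2 (vec4 1 (t 2%N * b) (t 2%N * c) (t 2%N * d))
                    (vec4 0 1 (t 0%N) (t 1%N)) : 'M[K]_(4, 2).
have Pe2 : P *m vec4 0 0 1 0 = y1.
  by rewrite mul_cols4_vec4 !scale0r scale1r !add0r addr0.
have Pe3 : P *m vec4 0 0 0 1 = y2.
  by rewrite mul_cols4_vec4 !scale0r scale1r !add0r.
pose l k := nth 0 [:: covec4 1 0 0 0; covec4 1 0 0 0; covec4 0 1 0 0] k : 'rV[K]_4.
pose m k := nth 0 [:: covec4 0 0 1 0; covec4 0 0 0 1; covec4 0 0 0 1] k : 'rV[K]_4.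
apply: (@family_chain 3 _ P Phi l m) => //.
- affine_tac.
- move=> p t hp; apply: camera_image_colspan hp _ => // E hE; apply: hL.
  have := hE; rewrite mul_cols2 !mul_cols4_vec4 => hE'.
  have [x0 _ _] := line_cols2_neq0 hE'.
  exists (1 *: u + ((t 2%N * b) *: v + ((t 2%N * c) *: y1 + (t 2%N * d) *: y2))).
  split; [exact: x0 | by rewrite hE' mem_cols2l |].
  by rewrite -!scalerA -!scalerDr -/w scale1r rpredD // rpredZ.
- have -> : P *m Phi (fun=> 0) = cols2 u v.
    by rewrite mul_cols2 !mul_cols4_vec4 !mul0r !scale0r !scale1r !addr0 add0r.
  apply: defined_at_centers hcs _ cs0 hcv.
  by move: frP; rewrite -[[:: u; v; y1; y2]]/([:: u; v] ++ [:: y1; y2]) cat_free => /and3P[].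
- case=> [|[|[|//]]] _; [exists (vec4 0 0 0 1) | exists (vec4 0 0 1 0)
    | exists (vec4 0 0 1 0)]; rewrite ?Pe2 ?Pe3;
  by split=> //; apply: covec4_vec4; ring.
- case=> [|[|[|//]]] t _ ht; have := ht _ (leqnn _); rewrite wedge_cols2 => ->; ring.
case=> [|[|[|//]]] _.
- exists (fun j => (j == 0%N)%:R) => [j kj|]; first by rewrite gtn_eqF.
  by rewrite wedge_cols2 /= (_ : _ - _ = 1) ?oner_eq0 //; ring.
- exists (fun j => (j == 1%N)%:R) => [j kj|]; first by rewrite gtn_eqF.
  by rewrite wedge_cols2 /= (_ : _ - _ = 1) ?oner_eq0 //; ring.
have [d0|d0] := eqVneq d 0.
  exists (fun j => if j == 1%N then 1 else (j == 2%N)%:R) => [[|[|[|j]]] //|].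
  rewrite wedge_cols2 /= (_ : _ - _ = b); last by rewrite d0; ring.
  by move: bd; rewrite d0 eqxx orbF.
exists (fun j => (j == 2%N)%:R) => [[|[|[|j]]] //|].
by rewrite wedge_cols2 /= (_ : _ - _ = - d) ?oppr_eq0 //; ring.
Qed.

(** Replacing [x0] by [x0 + s *: x1] and [x2] by [x2 + s *: x3] changes the
second coordinate [b] of a point into [b - s * a], where [a] is the first one.
As [a] and [b] do not both vanish on [cs], each point excludes one value of
[s].  Shearing both pairs at once keeps the line spanned by [x0 + x2] and
[x1 + x3]. *)
Lemma sheared_basis (x0 x1 x2 x3 : vec) (cs : seq vec) : free [:: x0; x1; x2; x3] ->
  (forall c, c \in cs -> c \notin <<[:: x2; x3]>>%VS) ->
  exists s, let P := cols4 (x0 + s *: x1) x1 (x2 + s *: x3) x3 in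
    P \in unitmx /\ forall w, P *m w \in cs -> w 1 0 != 0.
Proof.
move=> fr hcs; have uP0 := cols4_unit fr; set P0 := cols4 _ _ _ _ in uP0.
pose xi (c : vec) := invmx P0 *m c.
have [c s s' ccs /eqP e /eqP e'|s hs] :=
    @exists_avoiding _ _ cs (fun c s => xi c 1 0 == s * xi c 0 0).
  have xi0 : xi c 0 0 != 0.
    apply: contra (hcs c ccs) => /eqP c0; apply/memv_span2.
    exists (xi c 2 0), (xi c 3 0); rewrite -{1}[c](mulKVmx uP0) -/(xi c) mul_cols4.
    by rewrite e c0 mulr0 !scale0r !add0r.
  by apply: (mulIf xi0); rewrite -e -e'.
exists s => P.
have PE w : P *m w = P0 *m vec4 (w 0 0) (s * w 0 0 + w 1 0) (w 2 0) (s * w 2 0 + w 3 0).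
  rewrite mul_cols4_vec4 mul_cols4 !scalerDr !scalerDl !scalerA !addrA.
  by rewrite ![_ * s]mulrC.
split.
  apply: unitmx_inj => w; rewrite PE => /(congr1 (mulmx (invmx P0))).
  rewrite mulKmx // mulmx0 => /colP e.
  have w0 : w 0 0 = 0 by have := e 0; rewrite !mxE.
  have w1 : w 1 0 = 0 by have := e 1; rewrite !mxE /= w0 mulr0 add0r.
  have w2 : w 2 0 = 0 by have := e 2; rewrite !mxE.
  have w3 : w 3 0 = 0 by have := e 3; rewrite !mxE /= w2 mulr0 add0r.
  by apply/colP; apply: ord4P; rewrite mxE.
move=> w /hs; apply: contra => /eqP w1; rewrite /xi PE mulKmx // !mxE /= w1.
by rewrite addr0.
Qed.

Lemma sheared_coordinates (x0 x1 x2 x3 : vec) (cs : seq vec) (y : vec) :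
  free [:: x0; x1; x2; x3] ->
  (forall c, c \in cs -> c \notin <<[:: x2; x3]>>%VS) ->
  y \in cs -> y \notin <<[:: x0; x1]>>%VS ->
  exists s a b c d, let P := cols4 (x0 + s *: x1) x1 (x2 + s *: x3) x3 in
    [/\ P \in unitmx, forall w, P *m w \in cs -> w 1 0 != 0,
        P *m vec4 a b c d = y, b != 0 & (d != 0) || (c != 0)].
Proof.
move=> fr csL ycs yL; have [s] := sheared_basis fr csL.
set P := cols4 _ _ _ _ => -[uP hw].
have ey := mulKVmx uP y; rewrite (vec4K (invmx P *m y)) in ey.
move: (_ 0 0) (_ 1 0) (_ 2 0) (_ 3 0) ey => a b c d ey.
exists s, a, b, c, d; split=> //.
  by have := hw (vec4 a b c d); rewrite ey ycs mxE => /(_ isT).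
rewrite -negb_and; apply: contra yL => /andP[/eqP d0 /eqP c0].
apply/memv_span2; exists a, (a * s + b).
by rewrite -ey mul_cols4_vec4 c0 d0 !scale0r !addr0 scalerDr scalerDl scalerA addrA.
Qed.

(** A point of the line spanned by the first and third basis vectors has second
coordinate 0. *)
Lemma two_columns_defined (P : 'M[K]_4) cs : P \in unitmx -> centers_among cs ->
  (forall w, P *m w \in cs -> w 1 0 != 0) ->
  forall i (w : 'cV_2),
    C i *m (P *m cols2 (vec4 1 0 0 0) (vec4 0 0 1 0)) *m w = 0 -> w = 0.
Proof.
move=> uP hcs hw; rewrite mul_cols2; set u := P *m _; set v := P *m _.
have comb k l : k *: u + l *: v = P *m vec4 k 0 l 0.
  rewrite /u /v !scalemxAr -mulmxDr; congr (_ *m _).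
  by apply/colP; apply: ord4P; rewrite !mxE /=; ring.
have hc c : c \in cs -> c \notin <<[:: u; v]>>%VS.
  move=> ccs; apply/memv_span2 => -[k [l e]]; have := hw (vec4 k 0 l 0).
  by rewrite -comb -e ccs mxE eqxx => /(_ isT).
apply: (defined_at_centers hcs _ _ hc) => [|c /hc].
  apply: free2_inj => k l; rewrite comb => /(congr1 (mulmx (invmx P))).
  rewrite mulKmx // mulmx0 => /colP e; have := e 0; have := e 2.
  by rewrite !mxE.
by apply: contraNneq => ->; rewrite mem0v.
Qed.

(** The line joins a point of [L1] to a point of [L2].  In a basis adapted to
the two lines and the center, [y] has coordinates [a, b, c, d] with [b]
nonzero.  The first separating form expresses that the line meets the join of
[y] with the initial point of [L2], the second that it meets the join of [y]
with the initial point of [L1]. *)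
Lemma two_transversals_chain (Lambda : set (Gr1 K 3)) (L1 L2 : {vspace vec}) cs
    (y : vec) :
  (0 < n)%N -> \dim L1 = 2%N -> \dim L2 = 2%N -> (L1 :&: L2 = 0)%VS ->
  (forall E : Gr1 K 3, incident E L1 -> incident E L2 -> Lambda E) ->
  centers_among cs -> (forall c, c \in cs -> c \notin L2) ->
  y \in cs -> y \notin L1 -> sees_through y ->
  exists Z, irreducible_chain (zariski_closure (camera_image C Lambda)) 2 Z.
Proof.
move=> n0 d1 d2 i12 hL hcs csL ycs yL hy.
have [x0 [x1 [f1 e1]]] := line_basis d1; have [x2 [x3 [f2 e2]]] := line_basis d2.
have fr : free [:: x0; x1; x2; x3] by apply: free4_direct; rewrite -?e1 -?e2.
rewrite e2 in csL; rewrite e1 in yL.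
have [s [a [b [c [d]]]]] := sheared_coordinates fr csL ycs yL.
set P := cols4 _ _ _ _ => -[uP hw ey b0 cd].
pose Phi t := cols2 (vec4 1 (t 1%N) 0 0) (vec4 0 0 1 (t 0%N)) : 'M[K]_(4, 2).
pose l k := nth 0 [:: covec4 b (- a) 0 0; covec4 0 (- c) b 0] k : 'rV[K]_4.
pose m (k : nat) := covec4 0 (- d) 0 b : 'rV[K]_4.
apply: (@family_chain 2 _ P Phi l m) => //.
- affine_tac.
- move=> p t hp; apply: camera_image_colspan hp _ => // E hE.
  have := hE; rewrite mul_cols2 !mul_cols4_vec4 => hE'.
  have [u0 v0 _] := line_cols2_neq0 hE'.
  apply: hL.
    eexists; split; [exact: u0 | by rewrite hE' mem_cols2l |].
    rewrite e1 !scale0r !addr0 scale1r rpredD ?rpredD ?rpredZ ?memv_span ?inE ?eqxx ?orbT //.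
  eexists; split; [exact: v0 | by rewrite hE' mem_cols2r |].
  by rewrite e2 !scale0r !add0r scale1r rpredD ?rpredD ?rpredZ ?memv_span ?inE ?eqxx ?orbT.
- exact: (two_columns_defined uP hcs hw).
- move=> k k2; exists (vec4 a b c d); rewrite ey; split=> //.
    by case: k k2 => [|[|//]] _; apply: covec4_vec4; ring.
  by apply: covec4_vec4; ring.
- case=> [|[|//]] t _ ht; have := ht _ (leqnn _); rewrite wedge_cols2 => ->; ring.
case=> [|[|//]] _.
- exists (fun j => (j == 0%N)%:R) => [j kj|]; first by rewrite gtn_eqF.
  by rewrite wedge_cols2 /= (_ : _ - _ = b * b) ?mulf_neq0 //; ring.
have [d0|d0] := eqVneq d 0.
  exists (fun j => ((j == 0%N) || (j == 1%N))%:R) => [[|[|j]] //|].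
  rewrite wedge_cols2 /= (_ : _ - _ = - b * c); last by rewrite d0; ring.
  by move: cd; rewrite d0 eqxx /= => c0; rewrite mulf_neq0 ?oppr_eq0.
exists (fun j => (j == 1%N)%:R) => [[|[|j]] //|].
by rewrite wedge_cols2 /= (_ : _ - _ = b * d) ?mulf_neq0 //; ring.
Qed.

(** In a basis as in [regulus_basis] the lines meeting all three are spanned by
[(1, t, 0, 0)] and [(0, 0, 1, t)].  The separating form expresses that the
line meets the join of [y] with the initial point of [L1]; its value is
[t 0 * b * (d - t 0 * c)]. *)
Lemma regulus_chain (Lambda : set (Gr1 K 3)) (L1 L2 L3 : {vspace vec}) cs (y : vec) :
  (0 < n)%N -> \dim L1 = 2%N -> \dim L2 = 2%N -> \dim L3 = 2%N ->
  (L1 :&: L2 = 0)%VS -> (L1 :&: L3 = 0)%VS -> (L2 :&: L3 = 0)%VS ->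
  (forall E : Gr1 K 3, incident E L1 -> incident E L2 -> incident E L3 -> Lambda E) ->
  centers_among cs -> (forall c, c \in cs -> c \notin L2) ->
  y \in cs -> y \notin L1 -> sees_through y ->
  exists Z, irreducible_chain (zariski_closure (camera_image C Lambda)) 1 Z.
Proof.
move=> n0 d1 d2 d3 i12 i13 i23 hL hcs csL ycs yL hy.
have [x0 [x1 [x2 [x3 [e1 e2 e3 fr]]]]] := regulus_basis d1 d2 d3 i12 i13 i23.
rewrite e2 in csL; rewrite e1 in yL.
have [s [a [b [c [d]]]]] := sheared_coordinates fr csL ycs yL.
set P := cols4 _ _ _ _ => -[uP hw ey b0 cd].
pose Phi t := cols2 (vec4 1 (t 0%N) 0 0) (vec4 0 0 1 (t 0%N)) : 'M[K]_(4, 2).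
pose l (k : nat) := covec4 0 (- c) b 0 : 'rV[K]_4.
pose m (k : nat) := covec4 0 (- d) 0 b : 'rV[K]_4.
apply: (@family_chain 1 _ P Phi l m) => //.
- affine_tac.
- move=> p t hp; apply: camera_image_colspan hp _ => // E hE.
  have := hE; rewrite mul_cols2 !mul_cols4_vec4 => hE'.
  have [u0 v0 uv0] := line_cols2_neq0 hE'.
  apply: hL.
  + eexists; split; [exact: u0 | by rewrite hE' mem_cols2l |].
    by rewrite e1 !scale0r !addr0 scale1r rpredD ?rpredD ?rpredZ ?memv_span ?inE ?eqxx ?orbT.
  + eexists; split; [exact: v0 | by rewrite hE' mem_cols2r |].
    by rewrite e2 !scale0r !add0r scale1r rpredD ?rpredD ?rpredZ ?memv_span ?inE ?eqxx ?orbT.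
  eexists; split; [exact: uv0 | |].
    by rewrite hE' -[X in X + _]scale1r -[X in _ + X]scale1r mem_cols2.
  rewrite e3; apply/memv_span2; exists 1, (s + t 0%N).
  by apply/colP => i; rewrite !mxE; ring.
- exact: (two_columns_defined uP hcs hw).
- move=> k k2; exists (vec4 a b c d); rewrite ey; split=> //; apply: covec4_vec4; ring.
- by case=> // t _ ht; rewrite wedge_cols2 (ht 0%N isT); ring.
(* At the parameter 1 the form is [b * (d - c)], at -1 it is [- b * (d + c)]. *)
case=> // _; have [dc|dc] := eqVneq d c.
  exists (fun j => - (j == 0%N)%:R) => [[|j] //|]; first by rewrite oppr0.
  rewrite wedge_cols2 /= (_ : _ - _ = - (b * (c *+ 2))); last by rewrite dc; ring.
  move: cd; rewrite dc orbb => c0.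
  by rewrite oppr_eq0 mulf_neq0 // mulrn_eq0.
exists (fun j => (j == 0%N)%:R) => [[|j] //|].
rewrite wedge_cols2 /= (_ : _ - _ = b * (d - c)); last by ring.
by rewrite mulf_neq0 // subr_eq0.
Qed.

End Families.

(** * Charts on families of lines *)

Section Charts.
Variable K : fieldType.
Local Notation vec := 'cV[K]_4.
Implicit Types (E : {vspace vec}) (u v x y z : vec).

(** The matrix belongs to one of the finitely many charts with [d] parameters
that [parametrized_chain_le] accepts. *)
Definition has_chart d (M : 'M[K]_(4, 2)) := exists ts : seq K,
  size ts = d /\ forall a j, M a j \in [:: 0, 1 & ts].

Lemma cols2_has_chart u v (ts1 ts2 : seq K) :
  (forall b, u b 0 \in [:: 0, 1 & ts1]) -> (forall b, v b 0 \in [:: 0, 1 & ts2]) ->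
  has_chart (size ts1 + size ts2) (cols2 u v).
Proof.
move=> hu hv; exists (ts1 ++ ts2); split; first exact: size_cat.
move=> a; apply: ord2P; rewrite mxE /= !inE mem_cat.
  by have := hu a; rewrite !inE => /or3P[] ->; rewrite ?orbT.
by have := hv a; rewrite !inE => /or3P[] ->; rewrite ?orbT.
Qed.

(** The first column takes [(size r).-1] parameters.  Its pivot [a] can be
cleared from the second column, which is left with three coordinates, hence
with two parameters after scaling. *)
Lemma pivot_chart E u (r : seq 'I_4) : \dim E = 2%N -> u \in E -> u != 0 ->
  uniq r -> (forall a, a \notin r -> u a 0 = 0) ->
  exists2 M, E = colspan M & has_chart ((size r).-1 + 2) M.
Proof.
move=> d2 uE u0 ur hr.
have [k [ts1 [a [k0 s1 ua0 h1]]]] := scale_to_chart u0 ur hr.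
have [v [vE v0 va]] := line_vanishing_coord a d2.
have [|b|l [ts2 [a' [l0 s2 _ h2]]]] := scale_to_chart (r := rem a (enum 'I_4)) v0.
- by rewrite rem_uniq ?enum_uniq.
- by rewrite (mem_rem_uniq _ (enum_uniq _)) !inE mem_enum andbT negbK => /eqP ->.
exists (cols2 (k *: u) (l *: v)).
  exact: colspan_pivot d2 uE vE ua0 v0 va k0 l0.
have := cols2_has_chart h1 h2.
by rewrite s1 s2 size_rem ?mem_enum // size_enum_ord.
Qed.

Lemma line_chart E : \dim E = 2%N -> exists2 M, E = colspan M & has_chart 4 M.
Proof.
move=> d2; have [u [uE u0 ua]] := line_vanishing_coord 0 d2.
apply: (pivot_chart (r := [:: 1; 2; 3]) d2 uE u0) => // b.
by apply: (ord4P (P := fun b => b \notin _ -> _)) b.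
Qed.

Lemma transversal_chart E u : \dim E = 2%N -> u \in E -> u != 0 ->
  u 2 0 = 0 -> u 3 0 = 0 -> exists2 M, E = colspan M & has_chart 3 M.
Proof.
move=> d2 uE u0 ua ub; apply: (pivot_chart (r := [:: 0; 1]) d2 uE u0) => // b.
by apply: (ord4P (P := fun b => b \notin _ -> _)) b.
Qed.

Lemma two_transversals_chart E u v : \dim E = 2%N -> u \in E -> v \in E ->
  u != 0 -> v != 0 -> u 2 0 = 0 -> u 3 0 = 0 -> v 0 0 = 0 -> v 1 0 = 0 ->
  exists2 M, E = colspan M & has_chart 2 M.
Proof.
move=> d2 uE vE u0 v0 u2 u3 v1 v2.
have [|b|k [ts1 [a [k0 s1 ua0 h1]]]] := scale_to_chart (r := [:: 0; 1]) u0.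
- by [].
- by apply: (ord4P (P := fun b => b \notin _ -> _)) b.
have [|b|l [ts2 [a' [l0 s2 _ h2]]]] := scale_to_chart (r := [:: 2; 3]) v0.
- by [].
- by apply: (ord4P (P := fun b => b \notin _ -> _)) b.
have va : v a 0 = 0.
  by move: ua0; apply: (ord4P (P := fun a => u a 0 != 0 -> _)) a;
     rewrite ?u2 ?u3 ?eqxx.
exists (cols2 (k *: u) (l *: v)); first exact: colspan_pivot d2 uE vE ua0 v0 va k0 l0.
by have := cols2_has_chart h1 h2; rewrite s1 s2.
Qed.

(** A point of [E] with equal halves forces the two halves of the spanning
vectors to be proportional, so the same parameter occurs in both columns. *)
Lemma regulus_chart E u v z : \dim E = 2%N -> u \in E -> v \in E -> z \in E ->
  u != 0 -> v != 0 -> z != 0 -> u 2 0 = 0 -> u 3 0 = 0 -> v 0 0 = 0 -> v 1 0 = 0 ->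
  z 0 0 = z 2 0 -> z 1 0 = z 3 0 -> exists2 M, E = colspan M & has_chart 1 M.
Proof.
move=> d2 uE vE zE u0 v0 z0 u2 u3 v1 v2 z02 z13.
have [|b|k [ts1 [a [k0 s1 ua0 h1]]]] := scale_to_chart (r := [:: 0; 1]) u0.
- by [].
- by apply: (ord4P (P := fun b => b \notin _ -> _)) b.
have va : v a 0 = 0.
  by move: ua0; apply: (ord4P (P := fun a => u a 0 != 0 -> _)) a;
     rewrite ?u2 ?u3 ?eqxx.
have n1 : (1 : K) != 0 := oner_neq0 _.
have := zE; rewrite {1}(colspan_pivot d2 uE vE ua0 v0 va n1 n1) !scale1r colspan_cols2.
case/memv_span2 => al [be ez].
have zb b : z b 0 = al * u b 0 + be * v b 0 by rewrite ez !mxE.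
move: z02 z13; rewrite !zb u2 u3 v1 v2 !mulr0 !addr0 !add0r => z02 z13.
have al0 : al != 0.
  apply: contraNneq z0 => al0; move: z02 z13; rewrite al0 !mul0r => /esym z2 /esym z3.
  by apply/eqP/colP; apply: ord4P; rewrite zb mxE al0 mul0r add0r ?v1 ?v2 ?mulr0.
have be0 : be != 0.
  apply: contraNneq z0 => be0; move: z02 z13; rewrite be0 !mul0r => z2 z3.
  by apply/eqP/colP; apply: ord4P; rewrite zb mxE be0 mul0r addr0 ?u2 ?u3 ?mulr0.
(* The scaling of [v] that makes its entries equal to those of [k *: u]. *)
have l0 : k * be / al != 0 by rewrite !mulf_neq0 ?invr_eq0.
exists (cols2 (k *: u) ((k * be / al) *: v)).
  exact: colspan_pivot d2 uE vE ua0 v0 va k0 l0.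
exists ts1; rewrite s1; split=> // b; apply: ord2P; rewrite mxE /=; first exact: h1.
move: b; apply: ord4P; rewrite mxE ?v1 ?v2 ?mulr0 ?mem_head //.
  have -> : k * be / al * v 2 0 = (k *: u) 0 0.
    by rewrite mxE mulrAC -(mulrA k) -z02 mulrCA mulrC mulKf.
  exact: h1.
have -> : k * be / al * v 3 0 = (k *: u) 1 0.
    by rewrite mxE mulrAC -(mulrA k) -z13 mulrCA mulrC mulKf.
exact: h1.
Qed.

(** A camera that kills the first basis vector only sees the line modulo it, as a
line in a three-dimensional space, which has two parameters. *)
Lemma projected_chart E : \dim E = 2%N -> vec4 1 0 0 0 \notin E ->
  exists M M', [/\ E = colspan M, has_chart 2 M' &
    forall m (A : 'M[K]_(m, 4)), A *m vec4 1 0 0 0 = 0 -> A *m M = A *m M'].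
Proof.
move=> d2 e0E; pose pr x := x - x 0 0 *: vec4 1 0 0 0.
have pr_a x a : a != 0 -> pr x a 0 = x a 0.
  move=> a0; rewrite !mxE (_ : _`_a = 0) ?mulr0 ?subr0 //.
  by case: a a0 => [[|[|[|[|//]]]] //].
have pr0 x : pr x 0 0 = 0 by rewrite !mxE /= mulr1 subrr.
have pr_neq0 x : x \in E -> x != 0 -> pr x != 0.
  move=> xE x0; rewrite subr_eq0; apply: contra e0E => /eqP ex.
  have x00 : x 0 0 != 0 by apply: contraNneq x0 => x00; rewrite ex x00 scale0r.
  by move: xE; rewrite ex rpredZeq (negbTE x00).
have [u [uE u0 u1]] := line_vanishing_coord 1 d2.
have [|b|k [ts1 [a [k0 s1 ua0 h1]]]] := scale_to_chart (r := [:: 2; 3]) (pr_neq0 u uE u0).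
- by [].
- by apply: (ord4P (P := fun b => b \notin _ -> _)) b; rewrite ?pr0 ?pr_a.
have a0 : a != 0 by apply: contraNneq ua0 => ->; rewrite pr0.
have [v [vE v0 va]] := line_vanishing_coord a d2.
have a1 : a != 1 by apply: contraNneq ua0 => ->; rewrite pr_a ?u1.
have a123 : a \in [:: 1; 2; 3 : 'I_4].
  suff sub : forall a' : 'I_4, a' != 0 -> a' \in [:: 1; 2; 3 : 'I_4] by exact: sub.
  exact: ord4P.
have [||l [ts2 [a' [l0 s2 _ h2]]]] :=
    scale_to_chart (r := rem a [:: 1; 2; 3]) (pr_neq0 v vE v0).
- by rewrite rem_uniq.
- move=> b; rewrite mem_rem_uniq // inE negb_and negbK => /orP[/eqP ->|].
    by rewrite pr_a.
  by apply: (ord4P (P := fun b => b \notin _ -> _)) b; rewrite ?pr0.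
exists (cols2 (k *: u) (l *: v)), (cols2 (k *: pr u) (l *: pr v)); split.
- by rewrite pr_a // in ua0; exact: colspan_pivot d2 uE vE ua0 v0 va k0 l0.
- by have := cols2_has_chart h1 h2; rewrite s1 s2 size_rem.
move=> m A Ae; rewrite !mul_cols2.
by congr cols2; rewrite /pr -!scalemxAr mulmxBr -scalemxAr Ae scaler0 subr0.
Qed.

End Charts.

(** * Bounds on the length of chains *)

Section ChainBounds.
Variables (K : numFieldType) (h n : nat) (C : 'I_n -> 'M[K]_(h.+1, 4)).
Local Notation vec := 'cV[K]_4.
Implicit Types (Lambda : set (Gr1 K 3)) (L : {vspace vec}).

(** Passing to the coordinates of the basis [P] replaces the cameras [C i] by
[C i *m P].  The matrix [M'] in a chart only has to give the same pictures as
a matrix spanning the line. *)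
Lemma chain_le_of_charts d (P : 'M[K]_4) Lambda : P \in unitmx ->
  (forall (E : Gr1 K 3) (E' : {vspace vec}), Lambda E -> \dim E' = 2%N ->
    (forall x, (x \in E') = (P *m x \in line_vs E)) ->
    (forall i, \dim (camera_map (C i) @: E) = 2%N) ->
    exists M M', [/\ E' = colspan M, has_chart d M' &
       forall i, C i *m P *m M = C i *m P *m M']) ->
  forall e Z, irreducible_chain (zariski_closure (camera_image C Lambda)) e Z ->
  (e <= d)%N.
Proof.
move=> uP hL; apply: (parametrized_chain_le (C := fun i => C i *m P)).
move=> p [E LE hp]; have dE := eqP (dim_line_vs E).
have [N eN] := exists_colspan dE.
have memE' x : (x \in colspan (invmx P *m N)) = (P *m x \in line_vs E).
  rewrite eN; apply/memv_colspanP/memv_colspanP => -[w ew]; exists w.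
    by rewrite ew -mulmxA mulKVmx.
  by rewrite -mulmxA -ew mulKmx.
have dE' : \dim (colspan (invmx P *m N)) = 2%N.
  apply/dim_colspan => w; rewrite -mulmxA => /(congr1 (mulmx P)).
  rewrite mulKVmx // mulmx0; move: w; apply/dim_colspan; by rewrite -eN.
have dC i : \dim (camera_map (C i) @: E) = 2%N.
  by rewrite -hp; exact/eqP/dim_line_vs.
have [M [M' [eM [ts [sts hts]] MM']]] := hL E _ LE dE' memE' dC.
exists M', ts; split=> // i; rewrite -MM' hp.
have -> : line_vs E = colspan (P *m M).
  apply/vspaceP => x; have := memE' (invmx P *m x); rewrite mulKVmx // => <-.
  rewrite eM; apply/memv_colspanP/memv_colspanP => -[w ew]; exists w.
    by rewrite -mulmxA -ew mulKVmx.
  by rewrite ew -mulmxA mulKmx.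
by rewrite camera_map_colspan mulmxA.
Qed.

Lemma lines_chain_le Lambda :
  forall e Z, irreducible_chain (zariski_closure (camera_image C Lambda)) e Z ->
  (e <= 4)%N.
Proof.
apply: (chain_le_of_charts (unitmx1 _ _)) => E E' _ d2 _ _.
by have [M eM hM] := line_chart d2; exists M, M.
Qed.

Lemma extend_free2 (x0 x1 : vec) : free [:: x0; x1] ->
  exists x2 x3, free [:: x0; x1; x2; x3].
Proof.
move=> fr.
have [x2 h2] : exists x, x \notin <<[:: x0; x1]>>%VS.
  by apply: exists_notin; rewrite dim_matrix; exact: leq_ltn_trans (dim_span _) _.
have [x3 h3] : exists x, x \notin <<[:: x2; x0; x1]>>%VS.
  by apply: exists_notin; rewrite dim_matrix; exact: leq_ltn_trans (dim_span _) _.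
exists x2, x3; rewrite (perm_free (Y := [:: x3; x2; x0; x1])).
  by rewrite free_cons h3 free_cons h2 fr.
rewrite (perm_catC [:: x0; x1] [:: x2; x3]).
rewrite -[X in perm_eq X _]/([:: x2; x3] ++ [:: x0; x1]).
by rewrite (perm_cat2r [:: x0; x1] _ [:: x3; x2]) (perm_catC [:: x2] [:: x3]).
Qed.

Section Coordinates.
Variables (x0 x1 x2 x3 : vec) (E : Gr1 K 3) (E' : {vspace vec}).
Hypothesis memE' : forall x, (x \in E') = (cols4 x0 x1 x2 x3 *m x \in line_vs E).

Lemma meets_coordinates (a b c d : K -> K -> K) (y z : vec) :
  incident E <<[:: y; z]>>%VS ->
  (forall k l, k *: y + l *: z =
     cols4 x0 x1 x2 x3 *m vec4 (a k l) (b k l) (c k l) (d k l)) ->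
  exists k l, let u := vec4 (a k l) (b k l) (c k l) (d k l) in u != 0 /\ u \in E'.
Proof.
case=> x [xn0 xE /memv_span2[k [l ex]]] hyz; exists k, l; rewrite hyz in ex.
split; last by rewrite memE' -ex.
by apply: contraNneq xn0 => u0; rewrite ex u0 mulmx0.
Qed.

Lemma meets_first : incident E <<[:: x0; x1]>>%VS ->
  exists u, [/\ u \in E', u != 0, u 2 0 = 0 & u 3 0 = 0].
Proof.
move/(meets_coordinates (a := fun k _ => k) (b := fun _ l => l) (c := fun _ _ => 0)
  (d := fun _ _ => 0)) => [k l|k [l [u0 uE]]].
  by rewrite mul_cols4_vec4 !scale0r !addr0.
by eexists; split; [exact: uE | | |]; rewrite ?mxE.
Qed.

Lemma meets_second : incident E <<[:: x2; x3]>>%VS ->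
  exists u, [/\ u \in E', u != 0, u 0 0 = 0 & u 1 0 = 0].
Proof.
move/(meets_coordinates (a := fun _ _ => 0) (b := fun _ _ => 0) (c := fun k _ => k)
  (d := fun _ l => l)) => [k l|k [l [u0 uE]]].
  by rewrite mul_cols4_vec4 !scale0r !add0r.
by eexists; split; [exact: uE | | |]; rewrite ?mxE.
Qed.

Lemma meets_diagonal : incident E <<[:: (x0 + x2)%R; (x1 + x3)%R]>>%VS ->
  exists u, [/\ u \in E', u != 0, u 0 0 = u 2 0 & u 1 0 = u 3 0].
Proof.
move/(meets_coordinates (a := fun k _ => k) (b := fun _ l => l) (c := fun k _ => k)
  (d := fun _ l => l)) => [k l|k [l [u0 uE]]].
  by rewrite mul_cols4_vec4; apply/colP => i; rewrite !mxE; ring.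
by eexists; split; [exact: uE | | |]; rewrite ?mxE.
Qed.

End Coordinates.

Lemma transversals_chain_le Lambda L : \dim L = 2%N ->
  (forall E : Gr1 K 3, Lambda E -> incident E L) ->
  forall e Z, irreducible_chain (zariski_closure (camera_image C Lambda)) e Z ->
  (e <= 3)%N.
Proof.
move=> /line_basis[x0 [x1 [f2 ->]]] hL; have [x2 [x3 fr]] := extend_free2 f2.
apply: (chain_le_of_charts (cols4_unit fr)) => E E' /hL mE d2 hE' _.
have [u [uE u0 u2 u3]] := meets_first hE' mE.
by have [M eM hM] := transversal_chart d2 uE u0 u2 u3; exists M, M.
Qed.

Lemma two_transversals_chain_le Lambda L1 L2 :
  \dim L1 = 2%N -> \dim L2 = 2%N -> (L1 :&: L2 = 0)%VS ->
  (forall E : Gr1 K 3, Lambda E -> incident E L1 /\ incident E L2) ->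
  forall e Z, irreducible_chain (zariski_closure (camera_image C Lambda)) e Z ->
  (e <= 2)%N.
Proof.
move=> /line_basis[x0 [x1 [f1 ->]]] /line_basis[x2 [x3 [f2 ->]]] i12 hL.
have fr := free4_direct f1 f2 i12.
apply: (chain_le_of_charts (cols4_unit fr)) => E E' /hL[m1 m2] d2 hE' _.
have [u [uE u0 u2 u3]] := meets_first hE' m1.
have [v [vE v0 v1 v2]] := meets_second hE' m2.
by have [M eM hM] := two_transversals_chart d2 uE vE u0 v0 u2 u3 v1 v2; exists M, M.
Qed.

Lemma regulus_chain_le Lambda L1 L2 L3 :
  \dim L1 = 2%N -> \dim L2 = 2%N -> \dim L3 = 2%N ->
  (L1 :&: L2 = 0)%VS -> (L1 :&: L3 = 0)%VS -> (L2 :&: L3 = 0)%VS ->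
  (forall E : Gr1 K 3, Lambda E -> [/\ incident E L1, incident E L2 & incident E L3]) ->
  forall e Z, irreducible_chain (zariski_closure (camera_image C Lambda)) e Z ->
  (e <= 1)%N.
Proof.
move=> d1 d2 d3 i12 i13 i23 hL.
have [x0 [x1 [x2 [x3 [e1 e2 e3 fr]]]]] := regulus_basis d1 d2 d3 i12 i13 i23.
rewrite e1 e2 e3 in hL.
apply: (chain_le_of_charts (cols4_unit fr)) => E E' /hL[m1 m2 m3] dE hE' _.
have [u [uE u0 u2 u3]] := meets_first hE' m1.
have [v [vE v0 v1 v2]] := meets_second hE' m2.
have [z [zE z0 z02 z13]] := meets_diagonal hE' m3.
by have [M eM hM] := regulus_chart dE uE vE zE u0 v0 z0 u2 u3 v1 v2 z02 z13; exists M, M.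
Qed.

Lemma common_center_chain_le Lambda (c : vec) : (0 < n)%N -> c != 0 ->
  (forall i, C i *m c = 0) ->
  forall e Z, irreducible_chain (zariski_closure (camera_image C Lambda)) e Z ->
  (e <= 2)%N.
Proof.
move=> n0 c0 hc.
have [x1 hx1] : exists x, x \notin <[c]>%VS.
  by apply: exists_notin; rewrite dim_matrix dim_vline; case: (c != 0).
have f2 : free [:: c; x1] by apply/free2P.
have [x2 [x3 fr]] := extend_free2 f2.
apply: (chain_le_of_charts (cols4_unit fr)) => E E' _ dE hE' dC.
have Pe : cols4 c x1 x2 x3 *m vec4 1 0 0 0 = c.
  by rewrite mul_cols4_vec4 !scale0r !addr0 scale1r.
have cE : vec4 1 0 0 0 \notin E'.
  rewrite hE' Pe; apply/negP => cE.
  have := limg_ker_dim (camera_map (C (Ordinal n0))) E.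
  rewrite dC (eqP (dim_line_vs E)) => dk.
  have /eqP : \dim (E :&: lker (camera_map (C (Ordinal n0)))) = 0%N.
    by apply/eqP; rewrite -(eqn_add2r 2) dk.
  rewrite dimv_eq0.
  move/eqP => k0; case/negP: c0; rewrite -memv0 -k0 memv_cap cE memv_ker lfunE /=.
  by rewrite hc.
have [M [M' [eM hM MM']]] := projected_chart dE cE.
by exists M, M'; split=> // i; apply: MM'; rewrite -mulmxA Pe hc.
Qed.

End ChainBounds.

(** * Centers of the cameras *)

Section CameraCenters.
Variable K : numFieldType.
Local Notation vec := 'cV[K]_4.

(** The kernel is a line, and by counting ranks the row space is its whole
annihilator. *)
Lemma rank3_kernel m (C : 'M[K]_(m, 4)) : \rank C = 3%N ->
  exists c : vec, [/\ c != 0, C *m c = 0,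
    forall x, C *m x = 0 -> exists a, x = a *: c &
    forall l : 'rV[K]_4, l *m c = 0 -> (l <= C)%MS].
Proof.
move=> rC.
have rk : \rank (kermx C^T) = 1%N by rewrite mxrank_ker mxrank_tr rC.
have /rowV0Pn[r rker r0] : kermx C^T != 0 by rewrite -mxrank_eq0 rk.
have Cr : C *m r^T = 0 by rewrite -[C]trmxK -trmx_mul (sub_kermxP rker) trmx0.
exists r^T; split=> //.
- by rewrite -trmx0 (inj_eq trmx_inj).
- move=> x Cx.
  have xker : (x^T <= kermx C^T)%MS.
    by apply/sub_kermxP; rewrite -trmx_mul Cx trmx0.
  have rr : \rank r = 1%N by rewrite rank_rV r0.
  have kr : (kermx C^T <= r)%MS.
    by rewrite -(geq_leqif (mxrank_leqif_sup rker)) rk rr.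
  have /sub_rVP[a ea] := submx_trans xker kr.
  by exists a; rewrite -[x]trmxK ea linearZ.
move=> l lr.
have Cker : (C <= kermx r^T)%MS by apply/sub_kermxP.
have kC : (kermx r^T <= C)%MS.
  by rewrite -(geq_leqif (mxrank_leqif_sup Cker)) mxrank_ker mxrank_tr rank_rV r0 rC.
by apply: submx_trans kC; apply/sub_kermxP.
Qed.

Lemma memv_center h (C : 'M[K]_(h.+1, 4)) x : (x \in center C) = (C *m x == 0).
Proof. by rewrite memv_ker lfunE. Qed.

Lemma proj_disjoint_notin m (U V : {vspace 'cV[K]_m.+1}) x :
  proj_disjoint U V -> x \in U -> x != 0 -> x \notin V.
Proof.
by move=> UV xU; apply: contra => xV; rewrite -memv0 -UV memv_cap xU.
Qed.

Lemma not_proj_disjoint m (U V : {vspace 'cV[K]_m.+1}) :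
  ~ proj_disjoint U V <-> exists x, [/\ x != 0, x \in U & x \in V].
Proof.
split=> [/eqP UV|[x [x0 xU xV]] UV].
  exists (vpick (U :&: V)); rewrite vpick0 UV.
  by have := memv_pick (U :&: V); rewrite memv_cap => /andP[-> ->].
by have := proj_disjoint_notin UV xU x0; rewrite xV.
Qed.

Lemma lines_meetingP g (L : 'I_g -> Gr1 K 3) E :
  lines_meeting L E <-> forall j, incident E (L j).
Proof.
split=> [hE j|hE j]; first exact: (not_proj_disjoint _ _).1 (hE j).
exact: (not_proj_disjoint _ _).2 (hE j).
Qed.

Variables (g h n : nat) (L : 'I_g -> Gr1 K 3) (C : 'I_n -> 'M[K]_(h.+1, 4)).
Hypotheses (n_gt0 : (0 < n)%N) (hC : forall i, full_rank (C i)).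
Hypothesis hCL : forall i j, proj_disjoint (center (C i)) (L j).

(** What the lower bounds ask from a viewpoint: the base line avoids it along with
[cs], and forms vanishing at it factor through a camera. *)
Definition views (cs : seq vec) (y : vec) := y \in cs /\ sees_through C y.

(** Invertible cameras have no center and any linear form factors through
them; two generic points act as viewpoints. *)
Lemma space_cameras_view : h = 3%N -> exists cs y1 y2,
  [/\ centers_among C cs,
      forall c, c \in cs -> c != 0 /\ forall j, c \notin line_vs (L j),
      views cs y1, views cs y2 & free [:: y1; y2]].
Proof.
move=> h3.
have rC i : \rank (C i) = 4%N by rewrite hC h3.
pose Us := 0%VS :: [seq line_vs (L j) | j <- enum 'I_g].
have dUs U : U \in Us -> (\dim U < dim vec)%N.
  rewrite inE dim_matrix => /orP[/eqP ->|/mapP[j _ ->]]; first by rewrite dimv0.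
  by rewrite (eqP (dim_line_vs _)).
have inUs j : line_vs (L j) \in Us.
  by rewrite inE; apply/orP; right; apply/mapP; exists j; rewrite ?mem_enum.
(* The zero subspace in [Us] ensures that [y1] and [y2] are nonzero. *)
have [y1 hy1] := avoid_subspaces dUs.
have [U|y2 hy2] := @avoid_subspaces K vec (<[y1]>%VS :: Us).
  rewrite inE => /orP[/eqP ->|/dUs //].
  by rewrite dim_matrix dim_vline; case: (y1 != 0).
have y10 : y1 != 0 by have := hy1 0%VS (mem_head _ _); rewrite memv0.
have y2U U : U \in Us -> y2 \notin U by move=> hU; apply: hy2; rewrite inE hU orbT.
have y20 : y2 != 0 by have := y2U 0%VS (mem_head _ _); rewrite memv0.
have sees y : sees_through C y.
  by exists (Ordinal n_gt0) => l _; apply: submx_full; rewrite /row_full rC.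
exists [:: y1; y2], y1, y2; split.
- move=> i x /(congr1 trmx)/eqP; rewrite trmx_mul trmx0 mulmx_free_eq0.
    by rewrite -trmx0 (inj_eq trmx_inj) => ->.
  by rewrite /row_free mxrank_tr rC.
- move=> c; rewrite !inE => /orP[] /eqP ->; split=> // j; [exact: hy1|exact: y2U].
- by split; rewrite ?mem_head.
- by split; rewrite // !inE eqxx orbT.
by apply/free2P; split=> //; apply: hy2; rewrite mem_head.
Qed.

Lemma plane_cameras_view : h = 2%N -> exists c : 'I_n -> vec,
  [/\ forall i, c i != 0, forall i, center (C i) = <[c i]>%VS,
      centers_among C (codom c), forall i j, c i \notin line_vs (L j) &
      forall i, views (codom c) (c i)].
Proof.
move=> h2; have rC i : \rank (C i) = 3%N by rewrite hC h2.
have [c hc] := fin_all_exists (fun i => rank3_kernel (rC i)).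
have c0 i : c i != 0 by have [] := hc i.
have ec i : center (C i) = <[c i]>%VS.
  have [_ Cc ker _] := hc i; apply/vspaceP => x; rewrite memv_center.
  apply/eqP/vlineP => [/ker //|[a ->]]; by rewrite -scalemxAr Cc scaler0.
exists c; split=> //.
- move=> i x Cx x0; have [_ _ /(_ x Cx)[a ex] _] := hc i.
  exists (c i); first exact: codom_f.
  exists a^-1; rewrite ex scalerA mulVf ?scale1r //.
  by apply: contraNneq x0 => a0; rewrite ex a0 scale0r.
- by move=> i j; apply: proj_disjoint_notin (hCL i j) _ (c0 i); rewrite ec memv_line.
move=> i; split; first exact: codom_f.
by exists i; have [] := hc i.
Qed.

Lemma cameras_view : h \in [:: 2; 3]%N -> exists cs y,
  [/\ centers_among C cs, forall c, c \in cs -> forall j, c \notin line_vs (L j) &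
      views cs y].
Proof.
rewrite !inE => /orP[] /eqP eh.
  have [c [_ _ hcs cL vc]] := plane_cameras_view eh.
  exists (codom c), (c (Ordinal n_gt0)); split=> // _ /codomP[i ->]; exact: cL.
have [cs [y1 [_ [hcs hL v1 _ _]]]] := space_cameras_view eh.
by exists cs, y1; split=> // c /hL[].
Qed.

Lemma cameras_view2 :
  h = 3%N \/ (h = 2%N /\ exists i j, proj_disjoint (center (C i)) (center (C j))) ->
  exists cs y1 y2,
  [/\ centers_among C cs,
      forall c, c \in cs -> c != 0 /\ forall j, c \notin line_vs (L j),
      views cs y1, views cs y2 & free [:: y1; y2]].
Proof.
case=> [|[h2 [i [j hij]]]]; first exact: space_cameras_view.
have [c [c0 ec hcs cL vc]] := plane_cameras_view h2.
exists (codom c), (c i), (c j); split=> //.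
  by move=> _ /codomP[k ->]; split.
apply/free2P; split=> //; rewrite -ec; apply: contraTN isT => cji.
by have := proj_disjoint_notin hij cji (c0 j); rewrite ec memv_line.
Qed.

(** Centers are points, so two centers that are not disjoint are equal. *)
Lemma common_center : h = 2%N ->
  ~ (exists i j, proj_disjoint (center (C i)) (center (C j))) ->
  exists2 c : vec, c != 0 & forall i, C i *m c = 0.
Proof.
move=> h2 none; have [c [c0 ec _ _ _]] := plane_cameras_view h2.
exists (c (Ordinal n_gt0)) => // i.
have /not_proj_disjoint[x [x0 xi xj]] :
    ~ proj_disjoint (center (C i)) (center (C (Ordinal n_gt0))).
  by move=> d; apply: none; exists i, (Ordinal n_gt0).
move: xi xj; rewrite memv_center => /eqP Cx; rewrite ec => /vlineP[a ex].
have a0 : a != 0 by apply: contraNneq x0 => a0; rewrite ex a0 scale0r.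
by move: Cx; rewrite ex -scalemxAr => /eqP; rewrite scaler_eq0 (negbTE a0) => /eqP.
Qed.

End CameraCenters.

(** * The dimension of the line multiview variety *)

Section Dimension.
Variables (K : numFieldType) (g h n : nat).
Variables (L : 'I_g -> Gr1 K 3) (C : 'I_n -> 'M[K]_(h.+1, 4)).
Hypotheses (hg : g \in [:: 0; 1; 2; 3]%N) (hh : h \in [:: 2; 3]%N).
Hypothesis n_gt0 : (0 < n)%N.
Hypothesis hL : forall j k, j != k -> proj_disjoint (L j) (L k).
Hypothesis hC : forall i, full_rank (C i).
Hypothesis hCL : forall i j, proj_disjoint (center (C i)) (L j).
Local Notation X := (camera_image C (lines_meeting L)).

Let dL j : \dim (L j) = 2%N := eqP (dim_line_vs (L j)).

Lemma variety_chain_le e Z : irreducible_chain (zariski_closure X) e Z ->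
  (e <= 4 - g)%N.
Proof.
have inc E : lines_meeting L E -> forall j, incident E (L j) by move/lines_meetingP.
move: hg L hL dL inc; rewrite !inE => /or4P[] /eqP eg; subst g => L0 hL0 dL0 inc.
- exact: lines_chain_le.
- by apply: (transversals_chain_le (dL0 0)) => E /inc.
- apply: (two_transversals_chain_le (dL0 0) (dL0 1) (hL0 0 1 isT)) => E /inc iE.
  by split.
apply: (regulus_chain_le (dL0 0) (dL0 1) (dL0 2)
  (hL0 0 1 isT) (hL0 0 2 isT) (hL0 1 2 isT)).
by move=> E /inc iE; split.
Qed.

Lemma variety_chain_exists :
  [\/ h = 3%N,
      [/\ h = 2%N, g \in [:: 0; 1]%N &
          exists i j, proj_disjoint (center (C i)) (center (C j))]
    | g \in [:: 2; 3]%N] ->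
  exists Z, irreducible_chain (zariski_closure X) (4 - g) Z.
Proof.
move=> cond.
have view2 : g \in [:: 0; 1]%N ->
    h = 3%N \/ (h = 2%N /\ exists i j, proj_disjoint (center (C i)) (center (C j))).
  move=> g01; case: cond => [|[h2 _ hij]|g23]; [by left|by right|].
  by move: g01 g23; rewrite !inE => /orP[] /eqP ->.
have inc (E : Gr1 K 3) : (forall j, incident E (L j)) -> lines_meeting L E.
  by move/lines_meetingP.
have [cs [y [hcs csL [ycs hy]]]] := cameras_view n_gt0 hC hCL hh.
have v2 := fun g01 => cameras_view2 n_gt0 hC hCL (view2 g01).
clear view2 cond; move: hg L hL dL hCL inc csL v2; rewrite !inE.
move=> /or4P[] /eqP eg; subst g => L0 hL0 dL0 hCL0 inc csL v2.
- have [cs' [y1 [y2 [hcs' cs0 [_ s1] [_ s2] fr]]]] := v2 isT.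
  apply: (lines_chain n_gt0 _ hcs' _ s1 s2 fr) => [E|c /cs0[] //].
  by apply: inc => -[].
- have [cs' [y1 [y2 [hcs' cs0 [c1 s1] [c2 s2] fr]]]] := v2 isT.
  apply: (transversals_chain n_gt0 (dL0 0) _ hcs' _ _ _ s1 s2 fr).
  + by move=> E iE; apply: inc => j; rewrite ord1.
  + by move=> c /cs0[].
  + by have [_] := cs0 _ c1.
  by have [_] := cs0 _ c2.
- apply: (two_transversals_chain n_gt0 (dL0 0) (dL0 1) (hL0 0 1 isT) _ hcs _ ycs _ hy).
  + by move=> E i0 i1; apply: inc; exact: ord2P.
  + by move=> c /csL.
  exact: csL.
apply: (regulus_chain n_gt0 (dL0 0) (dL0 1) (dL0 2) (hL0 0 1 isT) (hL0 0 2 isT)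
  (hL0 1 2 isT) _ hcs _ ycs _ hy).
- move=> E i0 i1 i2; apply: inc => -[[|[|[|//]]] hj].
  + by rewrite (_ : Ordinal hj = 0) //; apply: val_inj.
  + by rewrite (_ : Ordinal hj = 1) //; apply: val_inj.
  + by rewrite (_ : Ordinal hj = 2) //; apply: val_inj.
- by move=> c /csL.
exact: csL.
Qed.

Theorem line_multiview_dimension :
  has_dim (line_multiview_variety C (lines_meeting L)) (4 - g) <->
  [\/ h = 3%N,
      [/\ h = 2%N, g \in [:: 0; 1]%N &
          exists i j, proj_disjoint (center (C i)) (center (C j))]
    | g \in [:: 2; 3]%N].
Proof.
split=> [[[Z chZ] _]|cond]; last first.
  by split; [exact: variety_chain_exists | exact: variety_chain_le].
have /orP[/eqP h2|/eqP h3] : (h == 2%N) || (h == 3%N); last by constructor 1.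
  by move: hh; rewrite !inE.
have [g01|g23] := boolP (g \in [:: 0; 1]%N); last first.
  by constructor 3; move: hg g23; rewrite !inE => /or4P[] /eqP ->.
constructor 2; split=> //; apply: contrapT => none.
have [c c0 Cc] := common_center n_gt0 hC hCL h2 none.
have := common_center_chain_le n_gt0 c0 Cc chZ.
by move: g01; rewrite !inE => /orP[] /eqP ->.
Qed.

End Dimension.

Local Open Scope complex_scope.

Theorem proposition4p2 (R : realType) (g h n : nat)
    (hg : g \in [:: 0; 1; 2; 3]%N) (hh : h \in [:: 2; 3]%N) (hn : (1 <= n)%N)
    (L : 'I_g -> Gr1 R[i] 3)
    (hL : forall j k, j != k -> proj_disjoint (L j) (L k))
    (C : 'I_n -> 'M[R[i]]_(h.+1, 4))
    (hC : forall i, full_rank (C i))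
    (hCL : forall i j, proj_disjoint (center (C i)) (L j)) :
  has_dim (line_multiview_variety C (lines_meeting L)) (4 - g) <->
  [\/ h = 3%N,
      [/\ h = 2%N, g \in [:: 0; 1]%N &
          exists i j, proj_disjoint (center (C i)) (center (C j))]
    | g \in [:: 2; 3]%N].
Proof. exact: line_multiview_dimension. Qed.
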